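(* Let $\Bbbk$ be a commutative Noetherian unital ring and let $A$ be a graded symmetric $\Bbbk$-algebra, free of finite rank over $\Bbbk$. Let $n\in\mathbb Z_{>0}$, let $\Bbbk[z_1,\dots,z_n]$ be a polynomial algebra in $n$ generators, let $\mathfrak S_n$ be the symmetric group of rank $n$, and let $\mathcal H_n(A)$ be the rank $n$ affinization of $A$. Then: (i) $\mathcal H_n(A)$ is isomorphic to $\Bbbk[z_1,\dots,z_n]\otimes A^{\otimes n}\otimes\Bbbk\mathfrak S_n$ as a $\Bbbk$-module. (ii) $\mathcal H_n(A)$ is free as a left/right $\Bbbk[z_1,\dots,z_n]$-module, free as a left/right $A^{\otimes n}$-module, and free as a left/right $\Bbbk\mathfrak S_n$-module. (iii) The center of $\mathcal H_n(A)$ is $Z(\mathcal H_n(A))=(\Bbbk[z_1,\dots,z_n]\otimes Z(A)^{\otimes n})^{\mathfrak S_n}$, the subalgebra of invariants under the diagonal action of $\mathfrak S_n$. (iv) The wreath product $A\wr\mathfrak S_n$ is a homomorphic image of $\mathcal H_n(A)$.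
   Context: **Graded symmetric algebras.** $A$ is a $\mathbb Z$-graded unital associative $\Bbbk$-algebra, free of finite rank. $A^*=\bigoplus_{t}(A_t)^*$ is a graded $(A,A)$-bimodule via $(a_1\cdot f\cdot a_2)(b)=f(a_2ba_1)$, where elements of $(A_t)^*$ have degree $-t$. $A$ is graded symmetric if it is equipped with an $(A,A)$-bimodule isomorphism $\varphi:A\to A^*$ homogeneous of degree $-d$ for some $d\in\mathbb Z$. With $m:A\otimes A\to A$ the multiplication and $(A\otimes A)^*=A^*\otimes A^*$, set $\Delta:=(\varphi^{-1}\otimes\varphi^{-1})\circ m^*\circ\varphi:A\to A\otimes A$, homogeneous of degree $d$; $\Delta(1)$ is the distinguished element. For $1\le t<u\le n$, $\Delta_{t,u}\in A^{\otimes n}$ is the image of $\Delta(1)$ under the algebra map $A^{\otimes2}\to A^{\otimes n}$ putting the first factor in slot $t$, the second in slot $u$ and $1$ elsewhere. **Affinization.** $\mathfrak S_n$ (generated by simple transpositions $s_1,\dots,s_{n-1}$) acts on the left on $A^{\otimes n}$ by place permutation ${}^\sigma(a_1\otimes\cdots\otimes a_n)=a_{\sigma^{-1}1}\otimes\cdots\otimes a_{\sigma^{-1}n}$ and on $\Bbbk[z_1,\dots,z_n]$ by ${}^\sigma z_i=z_{\sigma i}$. $\mathcal H_n(A)$ is the free product of $\Bbbk$-algebras $\Bbbk[z_1,\dots,z_n]\star A^{\otimes n}\star\Bbbk\mathfrak S_n$ modulo the relations $\boldsymbol az_j=z_j\boldsymbol a$; $s_i\boldsymbol a={}^{s_i}\boldsymbol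 a\,s_i$; $s_iz_j-z_{s_ij}s_i=(\delta_{i,j}-\delta_{i+1,j})\Delta_{i,i+1}$, for all $\boldsymbol a\in A^{\otimes n}$, $1\le i\le n-1$, $1\le j\le n$. It is graded with $\deg z_j=d$, $\deg s_i=0$. **Other notation.** $Z(\cdot)$ denotes the center. $\Bbbk[z_1,\dots,z_n]\otimes Z(A)^{\otimes n}$ is considered as a subalgebra of $\Bbbk[z_1,\dots,z_n]\otimes A^{\otimes n}$, which is regarded as a subalgebra of $\mathcal H_n(A)$ via $f\otimes\boldsymbol a\mapsto f\boldsymbol a$; the diagonal action is $w\cdot(f\otimes\boldsymbol a)={}^wf\otimes{}^w\boldsymbol a$. The wreath product $A\wr\mathfrak S_n$ is $A^{\otimes n}\otimes\Bbbk\mathfrak S_n$ with $A^{\otimes n}$ and $\Bbbk\mathfrak S_n$ as subalgebras and $w\boldsymbol a={}^w\boldsymbol a\,w$ for $w\in\mathfrak S_n$, $\boldsymbol a\in A^{\otimes n}$.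
   Formalization: Part (iii) can fail as stated over a general Noetherian ring; here Z(A)^{⊗n} is read slot by slot, as the intersection over t of A⊗…⊗Z(A)⊗…⊗A, and the reading as the span of pure tensors of central elements is asserted when Z(A) is projective over the base ring. *)

(* Defs.v *)
From HB Require Import structures.
From mathcomp Require Import all_boot all_order all_fingroup all_algebra.
From mathcomp Require Import generic_quotient boolp mpoly.

Set Implicit Arguments.
Unset Strict Implicit.
Unset Printing Implicit Defensive.

Import GRing.Theory VectorInternalTheory.
Local Open Scope ring_scope.
Local Open Scope quotient_scope.

Definition noetherian (k : comNzRingType) : Prop :=
  forall I : k -> Prop,
    I 0 -> (forall x y, I x -> I y -> I (x + y)) ->
    (forall c x, I x -> I (c * x)) ->
  exists (m : nat) (g : 'I_m -> k),
    forall x, I x <-> exists c : 'I_m -> k, x = \sum_i c i * g i.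

Definition is_central (R : pzRingType) (x : R) : Prop :=
  forall y : R, x * y = y * x.

Section Free.
Variables (S H : pzRingType) (iota : S -> H).

(* H is an S-module through iota; c is only read on the finite duplicate-free
   list s. *)
Definition free_left : Prop :=
  exists (I : eqType) (b : I -> H),
    (forall h, exists (s : seq I) (c : I -> S),
        h = \sum_(i <- s) iota (c i) * b i) /\
    (forall (s : seq I) (c : I -> S), uniq s ->
        \sum_(i <- s) iota (c i) * b i = 0 -> forall i, i \in s -> c i = 0).

Definition free_right : Prop :=
  exists (I : eqType) (b : I -> H),
    (forall h, exists (s : seq I) (c : I -> S),
        h = \sum_(i <- s) b i * iota (c i)) /\
    (forall (s : seq I) (c : I -> S), uniq s ->
        \sum_(i <- s) b i * iota (c i) = 0 -> forall i, i \in s -> c i = 0).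

End Free.

(* The quotient of the free product P * T * G of three k-algebras by the
   two-sided ideal generated by the relations in R: formal expressions modulo
   the least k-algebra congruence that makes the three inclusions algebra
   morphisms and contains R. *)
Section FreeProduct.
Variables (k : comNzRingType) (P T G : algType k).

Inductive fterm : Type :=
  | FP of P | FT of T | FG of G
  | FAdd of fterm & fterm | FMul of fterm & fterm | FScale of k & fterm.

Variable R : fterm -> fterm -> Prop.

Inductive fcong : fterm -> fterm -> Prop :=
  | fc_rel x y : R x y -> fcong x y
  | fc_refl x : fcong x x
  | fc_sym x y : fcong x y -> fcong y x
  | fc_trans x y z : fcong x y -> fcong y z -> fcong x z
  | fc_add x x' y y' : fcong x x' -> fcong y y' -> fcong (FAdd x y) (FAdd x' y')
  | fc_mul x x' y y' : fcong x x' -> fcong y y' -> fcong (FMul x y) (FMul x' y')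
  | fc_scale c x x' : fcong x x' -> fcong (FScale c x) (FScale c x')
  | fc_addA x y z : fcong (FAdd x (FAdd y z)) (FAdd (FAdd x y) z)
  | fc_addC x y : fcong (FAdd x y) (FAdd y x)
  | fc_add0 x : fcong (FAdd (FP 0) x) x
  | fc_addN x : fcong (FAdd (FScale (-1) x) x) (FP 0)
  | fc_mulA x y z : fcong (FMul x (FMul y z)) (FMul (FMul x y) z)
  | fc_mul1l x : fcong (FMul (FP 1) x) x
  | fc_mul1r x : fcong (FMul x (FP 1)) x
  | fc_mulDl x y z : fcong (FMul (FAdd x y) z) (FAdd (FMul x z) (FMul y z))
  | fc_mulDr x y z : fcong (FMul x (FAdd y z)) (FAdd (FMul x y) (FMul x z))
  | fc_scaleA a b x : fcong (FScale a (FScale b x)) (FScale (a * b) x)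
  | fc_scale1 x : fcong (FScale 1 x) x
  | fc_scaleDr a x y : fcong (FScale a (FAdd x y)) (FAdd (FScale a x) (FScale a y))
  | fc_scaleDl a b x : fcong (FScale (a + b) x) (FAdd (FScale a x) (FScale b x))
  | fc_scaleAl a x y : fcong (FScale a (FMul x y)) (FMul (FScale a x) y)
  | fc_scaleAr a x y : fcong (FScale a (FMul x y)) (FMul x (FScale a y))
  | fc_PD p q : fcong (FP (p + q)) (FAdd (FP p) (FP q))
  | fc_PM p q : fcong (FP (p * q)) (FMul (FP p) (FP q))
  | fc_PZ a p : fcong (FP (a *: p)) (FScale a (FP p))
  | fc_T1 : fcong (FT 1) (FP 1)
  | fc_TD p q : fcong (FT (p + q)) (FAdd (FT p) (FT q))
  | fc_TM p q : fcong (FT (p * q)) (FMul (FT p) (FT q))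
  | fc_TZ a p : fcong (FT (a *: p)) (FScale a (FT p))
  | fc_G1 : fcong (FG 1) (FP 1)
  | fc_GD p q : fcong (FG (p + q)) (FAdd (FG p) (FG q))
  | fc_GM p q : fcong (FG (p * q)) (FMul (FG p) (FG q))
  | fc_GZ a p : fcong (FG (a *: p)) (FScale a (FG p)).

HB.instance Definition _ := gen_eqMixin fterm.
HB.instance Definition _ := gen_choiceMixin fterm.

Definition fcongb (x y : fterm) : bool := `[< fcong x y >].

Lemma fcongb_equiv : equiv_class_of fcongb.
Proof.
split=> [x|x y|y x z].
- by apply/asboolP; exact: fc_refl.
- by apply/idP/idP => /asboolP h; apply/asboolP; exact: fc_sym.
- by move=> /asboolP h1 /asboolP h2; apply/asboolP; exact: fc_trans h1 h2.
Qed.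

Canonical fcong_equiv := EquivRelPack fcongb_equiv.

Definition fprod : Type := {eq_quot fcong_equiv}.
HB.instance Definition _ := Choice.on fprod.
HB.instance Definition _ := EqQuotient.on fprod.

Definition fclass (x : fterm) : fprod := \pi x.

Lemma fclassP x y : fclass x = fclass y <-> fcong x y.
Proof.
split=> [/eqP|h]; first by rewrite eqmodE => /asboolP.
by apply/eqP; rewrite eqmodE; apply/asboolP.
Qed.

Lemma fclass_repr (x : fprod) : fclass (repr x) = x.
Proof. exact: reprK. Qed.

Lemma frepr_class x : fcong (repr (fclass x)) x.
Proof. by apply/fclassP; rewrite fclass_repr. Qed.

Definition fprod_add (x y : fprod) := fclass (FAdd (repr x) (repr y)).
Definition fprod_mul (x y : fprod) := fclass (FMul (repr x) (repr y)).
Definition fprod_scale (c : k) (x : fprod) := fclass (FScale c (repr x)).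
Definition fprod_zero := fclass (FP 0).
Definition fprod_one := fclass (FP 1).
Definition fprod_opp (x : fprod) := fprod_scale (-1) x.

Lemma fclassD x y : fprod_add (fclass x) (fclass y) = fclass (FAdd x y).
Proof. by apply/fclassP; apply: fc_add; exact: frepr_class. Qed.
Lemma fclassM x y : fprod_mul (fclass x) (fclass y) = fclass (FMul x y).
Proof. by apply/fclassP; apply: fc_mul; exact: frepr_class. Qed.
Lemma fclassZ c x : fprod_scale c (fclass x) = fclass (FScale c x).
Proof. by apply/fclassP; apply: fc_scale; exact: frepr_class. Qed.

Let fclassE := (fclassD, fclassM, fclassZ).

Local Ltac lift_class :=
  repeat match goal with
  | x : fprod |- _ => rewrite -(fclass_repr x); move: (repr x); clear x => x
  end;
  rewrite ?fclassE; apply/fclassP.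

Lemma fprod_addA : associative fprod_add.
Proof. by move=> x y z; lift_class; exact: fc_addA. Qed.
Lemma fprod_addC : commutative fprod_add.
Proof. by move=> x y; lift_class; exact: fc_addC. Qed.
Lemma fprod_add0 : left_id fprod_zero fprod_add.
Proof. by rewrite /fprod_zero => x; lift_class; exact: fc_add0. Qed.
Lemma fprod_addN : left_inverse fprod_zero fprod_opp fprod_add.
Proof. by rewrite /fprod_opp /fprod_zero => x; lift_class; exact: fc_addN. Qed.

HB.instance Definition _ :=
  GRing.isZmodule.Build fprod fprod_addA fprod_addC fprod_add0 fprod_addN.

Lemma fprod_mulA : associative fprod_mul.
Proof. by move=> x y z; lift_class; exact: fc_mulA. Qed.
Lemma fprod_mul1l : left_id fprod_one fprod_mul.
Proof. by rewrite /fprod_one => x; lift_class; exact: fc_mul1l. Qed.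
Lemma fprod_mul1r : right_id fprod_one fprod_mul.
Proof. by rewrite /fprod_one => x; lift_class; exact: fc_mul1r. Qed.
Lemma fprod_mulDl : left_distributive fprod_mul +%R.
Proof.
move=> x y z; rewrite -[_ + y]/(fprod_add x y) -[RHS]/(fprod_add _ _).
by lift_class; exact: fc_mulDl.
Qed.
Lemma fprod_mulDr : right_distributive fprod_mul +%R.
Proof.
move=> x y z; rewrite -[y + _]/(fprod_add y z) -[RHS]/(fprod_add _ _).
by lift_class; exact: fc_mulDr.
Qed.

HB.instance Definition _ :=
  GRing.Zmodule_isPzRing.Build fprod fprod_mulA fprod_mul1l fprod_mul1r
    fprod_mulDl fprod_mulDr.

Lemma fprod_scaleA a b x :
  fprod_scale a (fprod_scale b x) = fprod_scale (a * b) x.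
Proof. by lift_class; exact: fc_scaleA. Qed.
Lemma fprod_scale1 : left_id 1 fprod_scale.
Proof. by move=> x; lift_class; exact: fc_scale1. Qed.
Lemma fprod_scaleDr : right_distributive fprod_scale +%R.
Proof.
move=> a x y; rewrite -[x + _]/(fprod_add x y) -[RHS]/(fprod_add _ _).
by lift_class; exact: fc_scaleDr.
Qed.
Lemma fprod_scaleDl x : {morph fprod_scale^~ x : a b / a + b}.
Proof.
move=> a b; rewrite -[RHS]/(fprod_add _ _).
by lift_class; exact: fc_scaleDl.
Qed.

HB.instance Definition _ :=
  GRing.Zmodule_isLmodule.Build k fprod fprod_scaleA fprod_scale1
    fprod_scaleDr fprod_scaleDl.

(* No algType instance: fprod may be the zero ring. *)
Lemma fprod_scaleAl (a : k) (x y : fprod) : a *: (x * y) = (a *: x) * y.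
Proof.
rewrite -[LHS]/(fprod_scale a (fprod_mul x y)).
rewrite -[RHS]/(fprod_mul (fprod_scale a x) y).
by lift_class; exact: fc_scaleAl.
Qed.
Lemma fprod_scaleAr (a : k) (x y : fprod) : a *: (x * y) = x * (a *: y).
Proof.
rewrite -[LHS]/(fprod_scale a (fprod_mul x y)).
rewrite -[RHS]/(fprod_mul x (fprod_scale a y)).
by lift_class; exact: fc_scaleAr.
Qed.

Definition fprod_inP (p : P) : fprod := fclass (FP p).
Definition fprod_inT (t : T) : fprod := fclass (FT t).
Definition fprod_inG (g : G) : fprod := fclass (FG g).

End FreeProduct.

(* Unital associative k-algebras that are free of finite rank. *)
#[short(type="freeAlgType")]
HB.structure Definition FreeAlgebra (k : comNzRingType) :=
  {A of GRing.Algebra k A & Vector k A}.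

Section TensorPower.
Variables (k : comNzRingType) (A : freeAlgType k) (n : nat).

Definition fbasis (i : 'I_(dim A)) : A := r2v (delta_mx 0 i).
Definition fcoord (i : 'I_(dim A)) (a : A) : k := v2r a 0 i.

Lemma fcoord_is_linear i : scalar (fcoord i).
Proof. by move=> c x y; rewrite /fcoord linearP !mxE. Qed.
HB.instance Definition _ i :=
  GRing.isLinear.Build k A k *%R (fcoord i) (fcoord_is_linear i).

Lemma fcoordK (a : A) : \sum_i fcoord i a *: fbasis i = a.
Proof.
apply: (can_inj v2rK); rewrite linear_sum [RHS]row_sum_delta.
by apply: eq_bigr => i _; rewrite linearZ /= r2vK.
Qed.

Lemma fcoord_basis i j : fcoord i (fbasis j) = (i == j)%:R.
Proof. by rewrite /fcoord r2vK mxE eqxx. Qed.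

Definition tidx := {ffun 'I_n -> 'I_(dim A)}.

(* M (x) A^{(x) n}, in the basis e_{I 0} (x) ... (x) e_{I (n-1)} of A^{(x) n}
   indexed by the multi-indices I. *)
Definition mtensor (M : lmodType k) := {ffun tidx -> M}.
HB.instance Definition _ (M : lmodType k) := GRing.Lmodule.on (mtensor M).

(* m (x) (a 0 (x) ... (x) a (n-1)) *)
Definition mtens (M : lmodType k) (m : M) (a : 'I_n -> A) : mtensor M :=
  [ffun I : tidx => (\prod_t fcoord (I t) (a t) : k) *: m].

Definition tbasis (I : tidx) : 'I_n -> A := fun t => fbasis (I t).

Lemma mtens_basisE (M : lmodType k) (m : M) (I J : tidx) :
  mtens m (tbasis I) J = (I == J)%:R *: m.
Proof.
rewrite ffunE; congr (_ *: _).
have [->|neIJ] := eqVneq I J.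
  by rewrite big1 // => t _; rewrite fcoord_basis eqxx.
have [t neIJt] : exists t, I t != J t.
  apply/existsP; apply: contraNT neIJ => /existsPn h.
  by apply/eqP/ffunP => t; apply/eqP; rewrite -[_ == _]negbK h.
by rewrite (bigD1 t) //= fcoord_basis eq_sym (negPf neIJt) mul0r.
Qed.

Lemma mtensor_sum (M : lmodType k) (x : mtensor M) :
  x = \sum_I mtens (x I) (tbasis I).
Proof.
apply/ffunP => J; rewrite sum_ffunE (bigD1 J) //= mtens_basisE eqxx scale1r.
rewrite big1 ?addr0 // => I neIJ.
by rewrite mtens_basisE (negPf neIJ) scale0r.
Qed.

(* The place permutation
   ^w (a_1 (x) ... (x) a_n) = a_{w^-1 1} (x) ... (x) a_{w^-1 n}. *)
Definition tplace (M : lmodType k) (w : 'S_n) (x : mtensor M) : mtensor M :=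
  [ffun I : tidx => x [ffun t => I (w t)]].

Lemma tplace_mtens (M : lmodType k) (w : 'S_n) (m : M) (a : 'I_n -> A) :
  tplace w (mtens m a) = mtens m (fun t => a ((w^-1)%g t)).
Proof.
apply/ffunP => I; rewrite !ffunE; congr (_ *: _).
rewrite [RHS](reindex_inj (@perm_inj _ w)) /=.
by apply: eq_bigr => t _; rewrite ffunE permK.
Qed.

Definition tpow := mtensor k^o.
HB.instance Definition _ := GRing.Lmodule.on tpow.

Definition pure (a : 'I_n -> A) : tpow := mtens (1 : k^o) a.

Lemma pureE a I : pure a I = \prod_t fcoord (I t) (a t).
Proof. by rewrite ffunE /GRing.scale /= mulr1. Qed.

Lemma eq_pure a b : a =1 b -> pure a = pure b.
Proof.
move=> eab; apply/ffunP => I; rewrite !pureE.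
by apply: eq_bigr => t _; rewrite eab.
Qed.

Lemma tpow_sum (x : tpow) : x = \sum_I x I *: pure (tbasis I).
Proof.
rewrite {1}[x]mtensor_sum; apply: eq_bigr => I _.
apply/ffunP => J; rewrite !ffunE /GRing.scale /= !mulr1.
by rewrite /GRing.scale /= mulrC.
Qed.

(* The unique linear extension of e_I |-> g I. *)
Definition text (M : lmodType k) (g : tidx -> M) (x : tpow) : M :=
  \sum_I (x I : k) *: g I.

Lemma text_is_linear (M : lmodType k) (g : tidx -> M) : linear (text g).
Proof.
move=> c x y; rewrite /text scaler_sumr -big_split /=.
by apply: eq_bigr => I _; rewrite !ffunE scalerDl scalerA.
Qed.
HB.instance Definition _ (M : lmodType k) (g : tidx -> M) :=
  GRing.isLinear.Build k tpow M *:%R (text g) (text_is_linear g).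

Lemma text_basis (M : lmodType k) (g : tidx -> M) I : text g (pure (tbasis I)) = g I.
Proof.
rewrite /text (bigD1 I) //= mtens_basisE eqxx [_%:R *: _]mulr1 scale1r.
rewrite big1 ?addr0 // => J neJI.
by rewrite mtens_basisE eq_sym (negPf neJI) [_%:R *: _]mulr1 scale0r.
Qed.

Lemma text_eq (M : lmodType k) (f g : {linear tpow -> M}) :
  (forall I, f (pure (tbasis I)) = g (pure (tbasis I))) -> f =1 g.
Proof.
move=> efg x; rewrite [x]tpow_sum !linear_sum; apply: eq_bigr => I _.
by rewrite !linearZ efg.
Qed.

(* Slotwise multiplication: (a * b)_t = a_t b_t on pure tensors. *)
Definition tmul (x y : tpow) : tpow :=
  \sum_I \sum_J (x I * y J : k) *: pure (fun t => fbasis (I t) * fbasis (J t)).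

Definition tone : tpow := pure (fun=> 1).

Lemma tmul_pure a b : tmul (pure a) (pure b) = pure (fun t => a t * b t).
Proof.
apply/ffunP => K; rewrite [RHS]pureE sum_ffunE.
under [RHS]eq_bigr => t _.
  rewrite -{1}[a t]fcoordK mulr_suml linear_sum.
  under eq_bigr => i _.
    rewrite -{1}[b t]fcoordK mulr_sumr linear_sum.
    over.
  over.
rewrite bigA_distr_bigA /=; apply: eq_bigr => I _.
rewrite bigA_distr_bigA /= sum_ffunE; apply: eq_bigr => J _.
rewrite ffunE !pureE /GRing.scale /= -!big_split /=; apply: eq_bigr => t _.
by rewrite -scalerAl -scalerAr scalerA linearZ.
Qed.

Lemma tmul_linl y : linear (tmul^~ y).
Proof.
move=> c x x'; rewrite /tmul scaler_sumr -big_split /=.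
apply: eq_bigr => I _; rewrite scaler_sumr -big_split /=.
by apply: eq_bigr => J _; rewrite !ffunE scalerA -scalerDl mulrDl mulrA.
Qed.
Lemma tmul_linr x : linear (tmul x).
Proof.
move=> c y y'; rewrite /tmul scaler_sumr -big_split /=.
apply: eq_bigr => I _; rewrite scaler_sumr -big_split /=.
apply: eq_bigr => J _; rewrite !ffunE scalerA -scalerDl mulrDr.
by rewrite mulrCA.
Qed.

Definition tmull y x := tmul x y.
HB.instance Definition _ y :=
  GRing.isLinear.Build k tpow tpow *:%R (tmull y) (tmul_linl y).
HB.instance Definition _ x :=
  GRing.isLinear.Build k tpow tpow *:%R (tmul x) (tmul_linr x).

Lemma tmulA : associative tmul.
Proof.
move=> x y z; rewrite -[RHS]/(tmull z (tmul x y)).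
rewrite -[RHS]/((tmull z \o tmul x) y) -[LHS]/(tmul x (tmull z y)).
rewrite -[LHS]/((tmul x \o tmull z) y).
apply: (text_eq (f := tmul x \o tmull z)) => {y} J /=; rewrite /tmull.
rewrite -[LHS]/(tmull _ x) -[RHS]/((tmull z \o tmull _) x).
apply: (text_eq (g := tmull z \o tmull _)) => {x} I /=; rewrite /tmull.
rewrite -[LHS]/((tmul _ \o tmul _) z).
apply: (text_eq (f := tmul _ \o tmul _)) => {z} K /=.
by rewrite !tmul_pure; apply: eq_pure => t; rewrite mulrA.
Qed.

Lemma tmul1l : left_id tone tmul.
Proof.
move=> x; apply: (text_eq (g := idfun)) => I /=.
by rewrite tmul_pure; apply: eq_pure => t; rewrite mul1r.
Qed.
Lemma tmul1r : right_id tone tmul.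
Proof.
move=> x; rewrite -[LHS]/(tmull tone x).
apply: (text_eq (g := idfun)) => I /=.
by rewrite /tmull tmul_pure; apply: eq_pure => t; rewrite mulr1.
Qed.
Lemma tmulDl : left_distributive tmul +%R.
Proof. by move=> x y z; rewrite -[LHS]/(tmull z (x + y)) linearD. Qed.
Lemma tmulDr : right_distributive tmul +%R.
Proof. by move=> x y z; rewrite linearD. Qed.

Lemma text_prod a :
  text (fun I => \prod_t fbasis (I t)) (pure a) = \prod_t a t.
Proof.
under [RHS]eq_bigr => t _ do rewrite -[a t]fcoordK.
rewrite bigA_distr_bigA /=; apply: eq_bigr => I _.
by rewrite pureE scaler_prod.
Qed.

Lemma tone_neq0 : tone != 0.
Proof.
apply/eqP => e; have := text_prod (fun=> 1).
rewrite -/tone e linear0 big1 // => /eqP.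
by rewrite eq_sym oner_eq0.
Qed.

HB.instance Definition _ :=
  GRing.Zmodule_isNzRing.Build tpow tmulA tmul1l tmul1r tmulDl tmulDr tone_neq0.

Lemma tscaleAl (c : k) (x y : tpow) : c *: (x * y) = (c *: x) * y.
Proof. by rewrite -[RHS]/(tmull y (c *: x)) linearZ. Qed.
HB.instance Definition _ := GRing.Lmodule_isLalgebra.Build k tpow tscaleAl.
Lemma tscaleAr (c : k) (x y : tpow) : c *: (x * y) = x * (c *: y).
Proof. by rewrite -[RHS]/(tmul x (c *: y)) linearZ. Qed.
HB.instance Definition _ := GRing.Lalgebra_isAlgebra.Build k tpow tscaleAr.

Lemma tplace_is_linear (w : 'S_n) :
  linear (tplace w : tpow -> tpow).
Proof. by move=> c x y; apply/ffunP => I; rewrite !ffunE. Qed.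
HB.instance Definition _ (w : 'S_n) :=
  GRing.isLinear.Build k tpow tpow *:%R (tplace w : tpow -> tpow)
    (tplace_is_linear w).

Lemma tplaceM (w : 'S_n) (x y : tpow) :
  tplace w (x * y) = (tplace w x : tpow) * (tplace w y : tpow) :> tpow.
Proof.
pose p : {linear tpow -> tpow} := tplace w : tpow -> tpow.
rewrite -[LHS]/((p \o tmul x) y) -[RHS]/((tmul (p x) \o p) y).
apply: (text_eq (f := p \o tmul x) (g := tmul (p x) \o p)) => {y} J /=.
rewrite -[LHS]/((p \o tmull (pure (tbasis J))) x).
rewrite -[RHS]/((tmull (p (pure (tbasis J))) \o p) x).
apply: (text_eq (f := p \o tmull _) (g := tmull _ \o p)) => {x} I /=.
by rewrite /tmull tmul_pure !tplace_mtens [RHS]tmul_pure.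
Qed.

Lemma tplace_one (w : 'S_n) : tplace w (1 : tpow) = 1 :> tpow.
Proof. exact: tplace_mtens. Qed.

(* (s * t)%g is "s, then t". *)
Lemma tplace_comp (u v : 'S_n) (x : tpow) :
  tplace u (tplace v x) = tplace (v * u)%g x.
Proof.
apply/ffunP => I; rewrite !ffunE; congr (x _).
by apply/ffunP => t; rewrite !ffunE permM.
Qed.

Lemma tplace1 (x : tpow) : tplace 1%g x = x.
Proof.
by apply/ffunP => I; rewrite ffunE; congr (x _); apply/ffunP => t; rewrite ffunE perm1.
Qed.

End TensorPower.

(* The skew group algebra T # S_n: free left T-module on S_n, with
   (a u) (b v) = a ^u b (u o v). As the library's (v * u)%g is u o v, the left
   action laws below read ^u(^v x) = ^(v * u)%g x. *)
Section Skew.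
Variables (k : comNzRingType) (T : algType k) (n : nat).

Record sym_action := SymAction {
  sact :> 'S_n -> T -> T;
  sactP : forall w, linear (sact w);
  sactM : forall w x y, sact w (x * y) = sact w x * sact w y;
  sact_one : forall w, sact w 1 = 1;
  sact1 : forall x, sact 1%g x = x;
  sact_comp : forall u v x, sact u (sact v x) = sact (v * u)%g x }.

Definition skew_alg (act : sym_action) : Type := {ffun 'S_n -> T}.

Variable act : sym_action.
Local Notation skew := (skew_alg act).

HB.instance Definition _ := GRing.Lmodule.on skew.

Definition skew_in (a : T) (w : 'S_n) : skew :=
  [ffun u => if u == w then a else 0].

Definition skew_mul (x y : skew) : skew :=
  [ffun w => \sum_u \sum_(v | (v * u)%g == w) x u * act u (y v)].

Lemma skew_mulE x y w :
  skew_mul x y w = \sum_u x u * act u (y (w * u^-1)%g).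
Proof.
rewrite ffunE; apply: eq_bigr => u _.
rewrite (big_pred1 (w * u^-1)%g) // => v /=.
by rewrite (can2_eq (mulgK u) (mulgVK u)).
Qed.

HB.instance Definition _ w :=
  GRing.isLinear.Build k T T *:%R (act w) (sactP act w).

Lemma skew_mulA : associative skew_mul.
Proof.
move=> x y z; apply/ffunP => w; rewrite !skew_mulE.
under eq_bigr => u _.
  rewrite skew_mulE linear_sum mulr_sumr.
  rewrite (reindex_inj (mulIg u^-1)%g) /=.
  under eq_bigr => v _ do
    rewrite sactM sact_comp invMg invgK mulgA !mulgVK mulrA.
  over.
rewrite exchange_big /=; apply: eq_bigr => v _.
by rewrite skew_mulE mulr_suml; apply: eq_bigr => u _.
Qed.

Lemma skew_mul1l : left_id (skew_in 1 1%g) skew_mul.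
Proof.
move=> x; apply/ffunP => w; rewrite skew_mulE (bigD1 1%g) //= ffunE eqxx.
rewrite mul1r sact1 invg1 mulg1 big1 ?addr0 // => u /negPf ne.
by rewrite ffunE ne mul0r.
Qed.
Lemma skew_mul1r : right_id (skew_in 1 1%g) skew_mul.
Proof.
move=> x; apply/ffunP => w; rewrite skew_mulE (bigD1 w) //= ffunE mulgV eqxx.
rewrite sact_one mulr1 big1 ?addr0 // => u ne.
rewrite ffunE ifN ?linear0 ?mulr0 //.
by apply: contra ne => /eqP e; rewrite -[w](mulgVK u) e mul1g.
Qed.
Lemma skew_mulDl : left_distributive skew_mul +%R.
Proof.
move=> x y z; apply/ffunP => w; rewrite [RHS]ffunE !skew_mulE -big_split.
by apply: eq_bigr => u _; rewrite ffunE mulrDl.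
Qed.
Lemma skew_mulDr : right_distributive skew_mul +%R.
Proof.
move=> x y z; apply/ffunP => w; rewrite [RHS]ffunE !skew_mulE -big_split.
by apply: eq_bigr => u _; rewrite ffunE linearD mulrDr.
Qed.
Lemma skew_one_neq0 : skew_in 1 1%g != 0.
Proof.
apply/eqP => /ffunP /(_ 1%g) /eqP; rewrite !ffunE eqxx.
by rewrite oner_eq0.
Qed.
HB.instance Definition _ :=
  GRing.Zmodule_isNzRing.Build skew skew_mulA skew_mul1l skew_mul1r
    skew_mulDl skew_mulDr skew_one_neq0.
Lemma skew_scaleAl (c : k) (x y : skew) : c *: (x * y) = (c *: x) * y.
Proof.
apply/ffunP => w; rewrite [LHS]ffunE [in LHS]skew_mulE [RHS]skew_mulE.
by rewrite scaler_sumr; apply: eq_bigr => u _; rewrite ffunE scalerAl.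
Qed.
HB.instance Definition _ := GRing.Lmodule_isLalgebra.Build k skew skew_scaleAl.
Lemma skew_scaleAr (c : k) (x y : skew) : c *: (x * y) = x * (c *: y).
Proof.
apply/ffunP => w; rewrite [LHS]ffunE [in LHS]skew_mulE [RHS]skew_mulE.
rewrite scaler_sumr; apply: eq_bigr => u _.
by rewrite ffunE linearZ /= scalerAr.
Qed.
HB.instance Definition _ := GRing.Lalgebra_isAlgebra.Build k skew skew_scaleAr.

End Skew.

Section Groups.
Variables (k : comNzRingType) (n : nat).

Definition trivial_action : sym_action k^o n.
Proof. by exists (fun=> id). Defined.

Definition symalg := skew_alg trivial_action.
HB.instance Definition _ := GRing.Algebra.on symalg.
Definition symelt (w : 'S_n) : symalg := skew_in trivial_action 1 w.

Variable A : freeAlgType k.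

Definition place_action : sym_action (tpow A n) n :=
  SymAction (@tplace_is_linear k A n) (@tplaceM k A n)
    (@tplace_one k A n) (@tplace1 k A n) (@tplace_comp k A n).

Definition wreath := skew_alg place_action.
HB.instance Definition _ := GRing.Algebra.on wreath.

End Groups.

Section Graded.
Variables (k : comNzRingType) (A : freeAlgType k).

(* gr t is the homogeneous component A_t. *)
Record algebra_grading (gr : int -> A -> Prop) : Prop := {
  gr_lin : forall t (c : k) (x y : A), gr t x -> gr t y -> gr t (c *: x + y);
  gr_zero : forall t, gr t 0;
  gr_one : gr 0 1;
  gr_mul : forall t u x y, gr t x -> gr u y -> gr (t + u) (x * y);
  gr_span : forall x : A, exists (s : seq int) (c : int -> A),
    (forall t, gr t (c t)) /\ x = \sum_(t <- s) c t;
  gr_direct : forall (s : seq int) (c : int -> A), uniq s ->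
    (forall t, gr t (c t)) -> \sum_(t <- s) c t = 0 ->
    forall t, t \in s -> c t = 0 }.

(* (A^* )_s = (A_{-s})^*, the forms vanishing on A_u for all u != -s. *)
Definition dual_gr (gr : int -> A -> Prop) (s : int) (f : 'Hom(A, k^o)) : Prop :=
  forall u a, u != - s -> gr u a -> f a = 0.

(* phi : A -> A^* is an isomorphism of (A,A)-bimodules, with inverse psi, and
   is homogeneous of degree -d; the bimodule structure of A^* is
   (a1 . f . a2) b = f (a2 b a1). *)
Record graded_symmetric (gr : int -> A -> Prop) (d : int)
    (phi : {linear A -> 'Hom(A, k^o)}) (psi : 'Hom(A, k^o) -> A) : Prop := {
  gs_bimod : forall a1 a a2 b, phi (a1 * a * a2) b = phi a (a2 * b * a1);
  gs_phiK : cancel phi psi;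
  gs_psiK : cancel psi phi;
  gs_degree : forall t a, gr t a -> dual_gr gr (t - d) (phi a) }.

Variables (phi : {linear A -> 'Hom(A, k^o)}) (psi : 'Hom(A, k^o) -> A).

(* m^*(phi a) = \sum_(i, j) phi a (e_i e_j) e_i^* (x) e_j^*, to which
   psi (x) psi is applied. *)
Definition coprod (a : A) : tpow A 2 :=
  \sum_i \sum_j (phi a (fbasis i * fbasis j) : k) *:
    pure (fun t : 'I_2 => psi (linfun (fcoord (if t == 0 then i else j) : A -> k^o))).

Definition tplace2 (n : nat) (t u : 'I_n) : tpow A 2 -> tpow A n :=
  text (fun I => pure (fun v => if v == t then fbasis (I 0)
                                else if v == u then fbasis (I 1) else 1)).

Definition Delta (n : nat) (t u : 'I_n) : tpow A n := tplace2 t u (coprod 1).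

End Graded.

Section Affinization.
Variables (k : comNzRingType) (A : freeAlgType k) (n : nat).
Variables (phi : {linear A -> 'Hom(A, k^o)}) (psi : 'Hom(A, k^o) -> A).

Local Notation term := (fterm {mpoly k[n]} (tpow A n) (symalg k n)).
Local Notation z j := (FP _ _ ('X_j : {mpoly k[n]}) : term).
Local Notation ten a := (FT _ _ (a : tpow A n) : term).
Local Notation s i i' := (FG _ _ (symelt k (tperm i i')) : term).

(* s_i is the transposition of i and i' = i + 1. *)
Inductive aff_rel : term -> term -> Prop :=
  | aff_az a j : aff_rel (FMul (ten a) (z j)) (FMul (z j) (ten a))
  | aff_sa (i i' : 'I_n) a : i' = i.+1 :> nat ->
      aff_rel (FMul (s i i') (ten a))
              (FMul (ten (tplace (tperm i i') a)) (s i i'))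
  | aff_sz (i i' j : 'I_n) : i' = i.+1 :> nat ->
      aff_rel
        (FAdd (FMul (s i i') (z j))
              (FScale (-1) (FMul (z (tperm i i' j)) (s i i'))))
        (ten (((i == j)%:R - (i' == j)%:R : k) *: Delta phi psi i i')).

Definition affinization := fprod aff_rel.
HB.instance Definition _ := GRing.PzRing.on affinization.
HB.instance Definition _ := GRing.Lmodule.on affinization.

Definition aff_poly (p : {mpoly k[n]}) : affinization := fprod_inP aff_rel p.
Definition aff_tens (a : tpow A n) : affinization := fprod_inT aff_rel a.
Definition aff_sym (g : symalg k n) : affinization := fprod_inG aff_rel g.

(* k[z_1, ..., z_n] (x) A^{(x) n} *)
Definition polytens := mtensor A n {mpoly k[n]}.
HB.instance Definition _ := GRing.Lmodule.on polytens.

(* k[z_1, ..., z_n] (x) A^{(x) n} (x) k S_n, in the basis S_n of k S_n. *)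
Definition polytens_sym : Type := {ffun 'S_n -> polytens}.
HB.instance Definition _ := GRing.Lmodule.on polytens_sym.

(* f (x) a |-> f a *)
Definition aff_embed (x : polytens) : affinization :=
  \sum_I aff_poly (x I) * aff_tens (pure (tbasis I)).

Definition diag_act (w : 'S_n) (x : polytens) : polytens :=
  [ffun I => msym w (tplace w x I)].

Definition diag_invariant (x : polytens) : Prop := forall w, diag_act w x = x.

(* The span of the f (x) (a_1 (x) ... (x) a_n) with a_t central in A for all t
   in S. *)
Definition central_slots (S : {set 'I_n}) (x : polytens) : Prop :=
  exists (m : nat) (f : 'I_m -> {mpoly k[n]}) (a : 'I_m -> 'I_n -> A),
    (forall i t, t \in S -> is_central (a i t)) /\
    x = \sum_i mtens (f i) (a i).

End Affinization.

(* k[z_1, ..., z_n] (x) Z(A)^{(x) n} inside k[z_1, ..., z_n] (x) A^{(x) n}, as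
   the span of the pure tensors with all slots central. *)
Definition pure_center (k : comNzRingType) (A : freeAlgType k) (n : nat)
    (x : polytens A n) : Prop := central_slots [set: 'I_n] x.

(* The same, read slot by slot: the intersection over t of
   k[z] (x) A (x) ... (x) Z(A) (x) ... (x) A, with Z(A) in slot t.
   The two readings agree if Z(A) is flat over k, but not in general, and only
   this one describes a centre over every k. For instance let k = F[e]/(e^2),
   B = k<x,y>/(x^2, y^2, yx - (1 + e)xy) and let A = B (+) B^* be the trivial
   extension: then e(x (x) x) is central in A (x) A, whereas the image of
   Z(A) (x) Z(A) has zero component in bidegree (deg x, deg x). *)
Definition slotwise_center (k : comNzRingType) (A : freeAlgType k) (n : nat)
    (x : polytens A n) : Prop := forall t, central_slots [set t] x.

(* Z(A) is a direct summand of some k^m. Over a Noetherian k, where Z(A) is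
   finitely generated, this is flatness of Z(A); it holds whenever k is a field or a Dedekind domain. *)
Definition projective_center (k : comNzRingType) (A : freeAlgType k) : Prop :=
  exists (m : nat) (p : {linear 'rV[k]_m -> A}) (s : A -> 'rV[k]_m),
    [/\ forall v, is_central (p v),
        forall (c : k) (x y : A), is_central x -> is_central y ->
          s (c *: x + y) = c *: s x + s y
      & forall x : A, is_central x -> p (s x) = x].

(* Main.v *)
(* The rank n affinization acts on Q = (+)_w w (x) M, where M = k[z] (x) A^{(x) n}
   and w runs over S_n. Only the action of z_j is not the obvious one: moving z_j
   to the right of w produces a term +-Delta (t j) w for each inversion of w^-1 at j.
   That these operators commute is a formal consequence of the other relations,
   because they make S_n permute the commutators [z_j, z_l], which vanish on
   1 (x) M. Applying h to 1 (x) 1 then inverts q |-> \sum_w w q(w), which proves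
   (i) and freeness on the side where w comes first. With w last one gets the same
   map up to the diagonal twist and terms of lower degree in z, hence again a
   bijection.

   For the centre, an element commuting with the z_j has no component off w = 1, by
   comparing top degrees; then s_i f = ^{s_i}f s_i + g Delta with
   (z_i - z_{i+1}) g = f - ^{s_i}f turns commutation with s_i into diagonal
   invariance. The map onto the wreath product sends z_j to the Jucys-Murphy
   element -\sum_{t < j} Delta_{j,t} (t j). *)
From HB Require Import structures.
Require Import Defs.
From mathcomp Require Import all_boot all_order all_fingroup all_algebra.
From mathcomp Require Import generic_quotient ssrcomplements mpoly zify.

Set Implicit Arguments.
Unset Strict Implicit.
Unset Printing Implicit Defensive.

Import GRing.Theory.
Local Open Scope ring_scope.

(** * Adjacent transpositions *)

Lemma tperm_conj_in (T : finType) (P : {perm T} -> Prop) :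
  (forall u v, P u -> P v -> P (u * v)%g) ->
  forall x y z : T, x != z -> x != y -> P (tperm x y) -> P (tperm y z) ->
  P (tperm x z).
Proof.
move=> PM x y z nxz nxy Pxy Pyz.
have -> : tperm x z = (tperm y z * tperm x y * tperm y z)%g.
  by rewrite -{1}[tperm y z]tpermV -mulgA -conjgE tpermJ tpermL tpermD // eq_sym.
by apply: (PM) => //; apply: (PM).
Qed.

Lemma perm_adjacent_ind (n : nat) (P : 'S_n -> Prop) :
  P 1%g ->
  (forall (i i' : 'I_n) w, i' = i.+1 :> nat -> P w -> P (w * tperm i i')%g) ->
  forall w, P w.
Proof.
move=> P1 PS.
pose Q u := forall w, P w -> P (w * u)%g.
have QM u v : Q u -> Q v -> Q (u * v)%g.
  by move=> hu hv w hw; rewrite mulgA; apply: hv; apply: hu.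
have Qadj (d : nat) (i j : 'I_n) : j = (i + d.+1)%N :> nat -> Q (tperm i j).
  elim: d i j => [|d IHd] i j ej.
    by move=> w; apply: PS; rewrite ej addn1.
  have lt : (i + d.+1 < n)%N by apply: leq_trans (ltn_ord j); rewrite ltnS ej leq_add2l.
  pose l := Ordinal lt.
  apply: (tperm_conj_in QM (y := l)) => //.
  - by rewrite -val_eqE /= ej -[X in X != _]addn0 eqn_add2l.
  - by rewrite -val_eqE /= -[X in X != _]addn0 eqn_add2l.
  - exact: IHd.
  - by move=> w; apply: PS; rewrite ej /= addnS.
have Qt i j : Q (tperm i j).
  have [lt|gt|e] := ltngtP i j.
  - by apply: (Qadj (j - i.+1)%N); rewrite addnS -addSn subnKC.
  - by rewrite tpermC; apply: (Qadj (i - j.+1)%N); rewrite addnS -addSn subnKC.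
  - by rewrite (val_inj e) tperm1 => w; rewrite mulg1.
move=> w; have [ts -> _] := prod_tpermP w.
suff : Q (\prod_(t <- ts) tperm t.1 t.2)%g by move/(_ _ P1); rewrite mul1g.
elim: ts => [|t ts IH]; first by rewrite big_nil => w' h; rewrite mulg1.
by rewrite big_cons; apply: QM.
Qed.

(** * Tensor powers and the Casimir element *)

Section TensorModule.
Variables (k : comNzRingType) (A : freeAlgType k) (n : nat) (M : lmodType k).
Local Notation B := (tpow A n).
Local Notation T := (mtensor A n M).
Local Notation e_ I := (pure (tbasis (A := A) I)).

Definition tens_lmul (b : B) (x : T) : T :=
  [ffun I => \sum_J (((b * e_ J : B) I : k) *: x J)].
Definition tens_rmul (b : B) (x : T) : T :=
  [ffun I => \sum_J (((e_ J * b : B) I : k) *: x J)].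

Lemma tens_lmulP b : linear (tens_lmul b).
Proof.
move=> c x y; apply/ffunP => I; rewrite !ffunE scaler_sumr -big_split /=.
by apply: eq_bigr => J _; rewrite !ffunE scalerDr scalerA mulrC -scalerA.
Qed.
HB.instance Definition _ b :=
  GRing.isLinear.Build k T T *:%R (tens_lmul b) (tens_lmulP b).

Lemma tens_rmulP b : linear (tens_rmul b).
Proof.
move=> c x y; apply/ffunP => I; rewrite !ffunE scaler_sumr -big_split /=.
by apply: eq_bigr => J _; rewrite !ffunE scalerDr scalerA mulrC -scalerA.
Qed.
HB.instance Definition _ b :=
  GRing.isLinear.Build k T T *:%R (tens_rmul b) (tens_rmulP b).

Lemma tens_lmul_linl c b b' x :
  tens_lmul (c *: b + b') x = c *: tens_lmul b x + tens_lmul b' x.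
Proof.
apply/ffunP => I; rewrite !ffunE scaler_sumr -big_split /=.
by apply: eq_bigr => J _; rewrite mulrDl -scalerAl !ffunE scalerDl scalerA.
Qed.
Lemma tens_rmul_linl c b b' x :
  tens_rmul (c *: b + b') x = c *: tens_rmul b x + tens_rmul b' x.
Proof.
apply/ffunP => I; rewrite !ffunE scaler_sumr -big_split /=.
by apply: eq_bigr => J _; rewrite mulrDr -scalerAr !ffunE scalerDl scalerA.
Qed.

Lemma tens_lmulDl b b' x : tens_lmul (b + b') x = tens_lmul b x + tens_lmul b' x.
Proof. by have := tens_lmul_linl 1 b b' x; rewrite !scale1r. Qed.
Lemma tens_lmulZl c b x : tens_lmul (c *: b) x = c *: tens_lmul b x.
Proof.
apply/ffunP => I; rewrite !ffunE scaler_sumr; apply: eq_bigr => J _.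
by rewrite -scalerAl !ffunE scalerA.
Qed.
Lemma basis_coord (I J : tidx A n) : (e_ I : B) J = (I == J)%:R :> k.
Proof. by rewrite mtens_basisE [_ *: _]mulr1. Qed.

Lemma tens_lmul1 x : tens_lmul 1 x = x.
Proof.
apply/ffunP => I; rewrite ffunE (bigD1 I) //= mul1r basis_coord eqxx scale1r.
by rewrite big1 ?addr0 // => J ne; rewrite mul1r basis_coord (negPf ne) scale0r.
Qed.
Lemma tens_rmul1 x : tens_rmul 1 x = x.
Proof.
apply/ffunP => I; rewrite ffunE (bigD1 I) //= mulr1 basis_coord eqxx scale1r.
by rewrite big1 ?addr0 // => J ne; rewrite mulr1 basis_coord (negPf ne) scale0r.
Qed.

Lemma tens_lmulM b c x : tens_lmul (b * c) x = tens_lmul b (tens_lmul c x).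
Proof.
apply/ffunP => I; rewrite !ffunE.
under [RHS]eq_bigr => J _ do rewrite ffunE scaler_sumr.
rewrite exchange_big /=; apply: eq_bigr => K _.
rewrite -mulrA {1}[c * _]tpow_sum mulr_sumr sum_ffunE scaler_suml.
by apply: eq_bigr => J _; rewrite -scalerAr ffunE scalerA mulrC.
Qed.
Lemma tens_rmulM b c x : tens_rmul (b * c) x = tens_rmul c (tens_rmul b x).
Proof.
apply/ffunP => I; rewrite !ffunE.
under [RHS]eq_bigr => J _ do rewrite ffunE scaler_sumr.
rewrite exchange_big /=; apply: eq_bigr => K _.
rewrite mulrA {1}[_ * b]tpow_sum mulr_suml sum_ffunE scaler_suml.
by apply: eq_bigr => J _; rewrite -scalerAl ffunE scalerA mulrC.
Qed.

Lemma tens_lrmul b c x :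
  tens_lmul b (tens_rmul c x) = tens_rmul c (tens_lmul b x).
Proof.
apply/ffunP => I; rewrite !ffunE.
under [LHS]eq_bigr => J _ do rewrite ffunE scaler_sumr.
under [RHS]eq_bigr => J _ do rewrite ffunE scaler_sumr.
rewrite exchange_big [RHS]exchange_big /=; apply: eq_bigr => K _.
transitivity ((b * (e_ K) * c : B) I *: x K).
  rewrite -mulrA {2}[_ * c]tpow_sum mulr_sumr sum_ffunE scaler_suml.
  by apply: eq_bigr => J _; rewrite -scalerAr ffunE scalerA mulrC.
rewrite {1}[b * _]tpow_sum mulr_suml sum_ffunE scaler_suml.
by apply: eq_bigr => J _; rewrite -scalerAl ffunE scalerA mulrC.
Qed.

Lemma tens_lmul_oneE (m : M) (b : B) I : tens_lmul b (mtens m (fun=> 1)) I = (b I : k) *: m.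
Proof.
rewrite ffunE -[in RHS](mulr1 b) [in RHS](tpow_sum 1) mulr_sumr sum_ffunE.
rewrite scaler_suml; apply: eq_bigr => J _.
have -> : mtens m (fun=> 1) J = ((1 : B) J : k) *: m.
  by rewrite [LHS]ffunE [(1 : B) J]pureE.
by rewrite -scalerAr [in RHS]ffunE scalerA mulrC.
Qed.

End TensorModule.

Section Slots.
Variables (k : comNzRingType) (A : freeAlgType k) (n : nat).
Local Notation B := (tpow A n).

Definition slot (t : 'I_n) (a : A) (c : 'I_n -> A) : 'I_n -> A :=
  fun v => if v == t then a else c v.

Lemma pure_slotE t a c (I : tidx A n) :
  pure (slot t a c) I = fcoord (I t) a * \prod_(v | v != t) fcoord (I v) (c v) :> k.
Proof.
rewrite pureE (bigD1 t) //= /slot eqxx; congr (_ * _).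
by apply: eq_bigr => v /negPf ->.
Qed.

Lemma pure_slotP t c : linear (fun a => pure (slot t a c) : B).
Proof.
move=> l a b; apply/ffunP => I; rewrite !ffunE.
rewrite -[LHS]/(_ *: (1 : k^o)) -(pureE (slot t _ c)).
have h x : (\prod_v fcoord (I v) (slot t x c v) : k) = (pure (slot t x c) : B) I.
  by rewrite pureE.
by rewrite !h !pure_slotE linearP /= mulrDl -mulrA /GRing.scale /= !mulr1.
Qed.

Lemma tplace2_pure (t u : 'I_n) (a : 'I_2 -> A) : t != u ->
  tplace2 t u (pure a) = pure (slot t (a 0) (slot u (a 1) (fun=> 1))).
Proof.
move=> ntu; apply/ffunP => K.
pose r := \prod_(v | (v != t) && (v != u)) fcoord (K v) (1 : A).
have slotsE x y : pure (slot t x (slot u y (fun=> 1))) K =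
    fcoord (K t) x * fcoord (K u) y * r.
  rewrite pure_slotE -mulrA; congr (_ * _).
  rewrite (bigD1 u) 1?eq_sym //= /slot eqxx; congr (_ * _).
  by apply: eq_bigr => v /andP[_ /negPf ->].
pose K' (s : 'I_2) := if s == 0 then K t else K u.
have -> : pure (slot t (a 0) (slot u (a 1) (fun=> 1))) K =
    (\prod_s fcoord (K' s) (a s)) * r.
  by rewrite slotsE !big_ord_recl big_ord0 /K' /= mulr1; congr (_ * fcoord _ (a _) * _); apply/val_inj.
under eq_bigr => s _.
  rewrite -[a s]fcoordK linear_sum /=.
  under eq_bigr => i _ do rewrite linearZ /=.
  over.
rewrite bigA_distr_bigA /= mulr_suml sum_ffunE; apply: eq_bigr => I _.
rewrite ffunE -[RHS]/(_ : k) big_split /= -mulrA -pureE; congr (_ * _).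
rewrite -/(slot t (fbasis (I 0)) (slot u (fbasis (I 1)) (fun=> 1))) slotsE.
rewrite !big_ord_recl big_ord0 /K' /= mulr1.
by congr (_ * fcoord _ (fbasis (I _)) * _); apply/val_inj.
Qed.

End Slots.

Section Casimir.
Variables (k : comNzRingType) (A : freeAlgType k) (gr : int -> A -> Prop) (d : int).
Variables (phi : {linear A -> 'Hom(A, k^o)}) (psi : 'Hom(A, k^o) -> A).
Hypothesis sym : graded_symmetric gr d phi psi.

Let tr (a : A) : k := phi 1 a.
Definition dual_basis i : A := psi (linfun (fcoord i : A -> k^o)).
Local Notation dual := dual_basis.
Local Notation e_ := (@fbasis k A).

Lemma gs_trace a b : phi a b = tr (b * a).
Proof. by have := gs_bimod sym a 1 1 b; rewrite !mulr1 mul1r. Qed.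
Lemma gs_trC a b : tr (a * b) = tr (b * a).
Proof. by have := gs_bimod sym 1 1 b a; rewrite !mul1r mulr1 gs_trace => ->. Qed.

Lemma gs_tr_dual i b : tr (dual i * b) = fcoord i b.
Proof. by rewrite gs_trC -gs_trace /dual (gs_psiK sym) lfunE. Qed.

Lemma gs_dual_expand a : a = \sum_l tr (a * e_ l) *: dual l.
Proof.
apply: (can_inj (gs_phiK sym)); apply/lfunP => b.
rewrite linear_sum sum_lfunE -[in LHS](fcoordK b) linear_sum.
apply: eq_bigr => l _; rewrite !linearZ /= lfunE /= !gs_trace.
by rewrite [tr (b * _)]gs_trC gs_tr_dual [tr (e_ l * _)]gs_trC /GRing.scale /= mulrC.
Qed.

Section Bilinear.
Variables (V : lmodType k) (F : A -> A -> V).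
Hypotheses (Fl : forall b, linear (F^~ b)) (Fr : forall a, linear (F a)).

Let FlS b (I : finType) (c : I -> k) (v : I -> A) :
  F (\sum_i c i *: v i) b = \sum_i c i *: F (v i) b.
Proof.
pose f : {linear A -> V} := HB.pack (F^~ b) (GRing.isLinear.Build _ _ _ _ _ (Fl b)).
by rewrite -[LHS]/(f _) linear_sum; apply: eq_bigr => i _; rewrite linearZ.
Qed.
Let FrS a (I : finType) (c : I -> k) (v : I -> A) :
  F a (\sum_i c i *: v i) = \sum_i c i *: F a (v i).
Proof.
pose f : {linear A -> V} := HB.pack (F a) (GRing.isLinear.Build _ _ _ _ _ (Fr a)).
by rewrite -[LHS]/(f _) linear_sum; apply: eq_bigr => i _; rewrite linearZ.
Qed.

Lemma casimir_coprod :
  \sum_i \sum_j tr (e_ i * e_ j) *: F (dual i) (dual j) = \sum_i F (dual i) (e_ i).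
Proof. by apply: eq_bigr => i _; rewrite [in RHS](gs_dual_expand (e_ i)) FrS. Qed.

Lemma casimir_shift x y :
  \sum_i F (dual i * x) (e_ i * y) = \sum_i F (y * dual i) (x * e_ i).
Proof.
transitivity (\sum_i F (dual i) (x * e_ i * y)).
  under eq_bigr => i _ do rewrite (gs_dual_expand (dual i * x)) FlS.
  rewrite exchange_big /=; apply: eq_bigr => l _.
  rewrite -(fcoordK (x * e_ l)) mulr_suml.
  under [in RHS]eq_bigr => i _ do rewrite -scalerAl.
  by rewrite FrS; apply: eq_bigr => i _; rewrite -mulrA gs_tr_dual.
symmetry; under eq_bigr => i _ do rewrite (gs_dual_expand (y * dual i)) FlS.
rewrite exchange_big /=; apply: eq_bigr => l _.
rewrite -mulrA -(fcoordK (e_ l * y)) mulr_sumr.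
under [in RHS]eq_bigr => i _ do rewrite -scalerAr.
by rewrite FrS; apply: eq_bigr => i _; rewrite -mulrA gs_trC -gs_tr_dual mulrA.
Qed.

End Bilinear.

Section Delta.
Variable n : nat.
Local Notation B := (tpow A n).
Local Notation Delta := (@Delta k A phi psi n).

Let one_ (v : 'I_n) : A := 1.

Lemma slot_slotC t u (a b : A) c : t != u ->
  slot t a (slot u b c) =1 slot u b (slot t a c) :> ('I_n -> A).
Proof. by move=> ntu v; rewrite /slot; case: eqP => // ->; rewrite (negPf ntu). Qed.

Lemma slot2_lin1 t u b (c : 'I_n -> A) :
  linear (fun a => pure (slot t a (slot u b c)) : B).
Proof. exact: pure_slotP. Qed.
Lemma slot2_lin2 t u a (c : 'I_n -> A) : t != u ->
  linear (fun b => pure (slot t a (slot u b c)) : B).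
Proof.
move=> ntu l x y; rewrite !(eq_pure (slot_slotC _ _ _ ntu)).
exact: pure_slotP.
Qed.

Lemma DeltaE t u : t != u ->
  Delta t u = \sum_i pure (slot t (dual i) (slot u (e_ i) one_)).
Proof.
move=> ntu; rewrite -(casimir_coprod (F := fun a b => pure (slot t a (slot u b one_)) : B)).
- rewrite /Defs.Delta /coprod /tplace2 linear_sum; apply: eq_bigr => i _.
  rewrite linear_sum; apply: eq_bigr => j _; rewrite linearZ /=.
  by congr (_ *: _); rewrite -/(tplace2 t u _) tplace2_pure.
- by move=> a; apply: slot2_lin2.
Qed.

Lemma DeltaC t u : t != u -> Delta t u = Delta u t.
Proof.
move=> ntu; have nut : u != t by rewrite eq_sym.
rewrite !DeltaE //.
rewrite -(casimir_coprod (F := fun a b => pure (slot t a (slot u b one_)) : B)); first last.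
- by move=> a; apply: slot2_lin2.
rewrite -(casimir_coprod (F := fun a b => pure (slot u a (slot t b one_)) : B)); first last.
- by move=> a; apply: slot2_lin2.
rewrite exchange_big /=; apply: eq_bigr => i _; apply: eq_bigr => j _.
by rewrite gs_trC (eq_pure (slot_slotC _ _ _ ntu)).
Qed.

Lemma tplace_Delta (w : 'S_n) t u : t != u -> tplace w (Delta t u) = Delta (w t) (w u).
Proof.
move=> ntu; rewrite !DeltaE ?(inj_eq perm_inj) // linear_sum.
apply: eq_bigr => i _; rewrite [LHS]tplace_mtens; apply: eq_pure => v.
by rewrite /slot -!(can2_eq (permKV w) (permK w)).
Qed.

Lemma Delta_comm t u (b : B) : t != u ->
  Delta t u * b = (tplace (tperm t u) b : B) * Delta t u.
Proof.
move=> ntu; pose f (x : B) : B := Delta t u * x.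
pose g (x : B) : B := (tplace (tperm t u) x : B) * Delta t u.
have fL : linear f by move=> c x y; rewrite /f mulrDr scalerAr.
have gL : linear g by move=> c x y; rewrite /g linearP mulrDl scalerAl.
pose fl : {linear B -> B} := HB.pack f (GRing.isLinear.Build _ _ _ _ _ fL).
pose gl : {linear B -> B} := HB.pack g (GRing.isLinear.Build _ _ _ _ _ gL).
rewrite -[LHS]/(fl b) -[RHS]/(gl b); apply: text_eq => {b} I /=.
rewrite /f /g DeltaE // mulr_suml mulr_sumr.
move: (tbasis I) => b.
transitivity (\sum_i (pure (slot t (dual i * b t) (slot u (e_ i * b u) b)) : B)).
  apply: eq_bigr => i _; rewrite [LHS]tmul_pure; apply: eq_pure => v.
  by rewrite /slot /one_; have [->//|] := eqVneq v t; have [->//|] := eqVneq v u; rewrite mul1r.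
rewrite (@casimir_shift _ (fun x y => pure (slot t x (slot u y b)) : B)); first last.
- by move=> a; apply: slot2_lin2.
- by move=> a; apply: slot2_lin1.
apply: eq_bigr => i _; rewrite [tplace _ _]tplace_mtens [RHS]tmul_pure; apply: eq_pure => v.
rewrite tpermV /slot /one_; have [->|nvt] := eqVneq v t; first by rewrite tpermL.
have [->|nvu] := eqVneq v u; first by rewrite tpermR.
by rewrite mulr1 tpermD // eq_sym.
Qed.

End Delta.
End Casimir.

(** * Modules over the affinization *)

Record alg_action (k : comNzRingType) (S : algType k) (V : lmodType k)
    (f : S -> V -> V) : Prop := AlgAction {
  act_lin : forall a, linear (f a);
  actDl : forall a b v, f (a + b) v = f a v + f b v;
  actZl : forall c a v, f (c *: a) v = c *: f a v;
  actMl : forall a b v, f (a * b) v = f a (f b v);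
  act1l : forall v, f 1 v = v }.

Section FreeProductAction.
Variables (k : comNzRingType) (P T G : algType k) (V : lmodType k).
Variable R : fterm P T G -> fterm P T G -> Prop.
Variables (fP : P -> V -> V) (fT : T -> V -> V) (fG : G -> V -> V).
Hypotheses (aP : alg_action fP) (aT : alg_action fT) (aG : alg_action fG).

Fixpoint term_act (x : fterm P T G) (v : V) : V :=
  match x with
  | FP p => fP p v
  | FT t => fT t v
  | FG g => fG g v
  | FAdd x y => term_act x v + term_act y v
  | FMul x y => term_act x (term_act y v)
  | FScale c x => c *: term_act x v
  end.

Hypothesis relP : forall x y, R x y -> term_act x =1 term_act y.

Lemma term_act_lin x : linear (term_act x).
Proof.
elim: x => [p|t|g|x IHx y IHy|x IHx y IHy|c x IHx] l u v /=.
- exact: act_lin aP _ _ _ _.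
- exact: act_lin aT _ _ _ _.
- exact: act_lin aG _ _ _ _.
- by rewrite IHx IHy scalerDr addrACA.
- by rewrite IHy IHx.
- by rewrite IHx scalerDr !scalerA mulrC.
Qed.

Lemma term_actD x u v : term_act x (u + v) = term_act x u + term_act x v.
Proof. by have := term_act_lin x 1 u v; rewrite !scale1r. Qed.
Lemma term_act0 x : term_act x 0 = 0.
Proof. by apply: (addrI (term_act x 0)); rewrite -term_actD !addr0. Qed.
Lemma term_actZ x c v : term_act x (c *: v) = c *: term_act x v.
Proof. by have := term_act_lin x c v 0; rewrite term_act0 !addr0. Qed.

Lemma act0l (S : algType k) (f : S -> V -> V) : alg_action f -> forall v, f 0 v = 0.
Proof. by move=> af v; apply: (addrI (f 0 v)); rewrite -(actDl af) !addr0. Qed.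

Lemma fcong_act x y : fcong R x y -> term_act x =1 term_act y.
Proof.
elim=> {x y} //=.
- by move=> x y _ IH v; rewrite IH.
- by move=> x y z _ IH1 _ IH2 v; rewrite IH1.
- by move=> x x' y y' _ IHx _ IHy v; rewrite IHx IHy.
- by move=> x x' y y' _ IHx _ IHy v; rewrite IHx IHy.
- by move=> c x x' _ IH v; rewrite IH.
- by move=> x y z v; rewrite addrA.
- by move=> x y v; rewrite addrC.
- by move=> x v; rewrite (act0l aP) add0r.
- by move=> x v; rewrite (act0l aP) scaleN1r addNr.
- by move=> x v; rewrite (act1l aP).
- by move=> x v; rewrite (act1l aP).
- by move=> x y z v; rewrite term_actD.
- by move=> a b x v; rewrite scalerA.
- by move=> x v; rewrite scale1r.
- by move=> a x y v; rewrite scalerDr.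
- by move=> a b x v; rewrite scalerDl.
- by move=> a x y v; rewrite term_actZ.
- by move=> p q v; rewrite (actDl aP).
- by move=> p q v; rewrite (actMl aP).
- by move=> a p v; rewrite (actZl aP).
- by move=> v; rewrite (act1l aT) (act1l aP).
- by move=> p q v; rewrite (actDl aT).
- by move=> p q v; rewrite (actMl aT).
- by move=> a p v; rewrite (actZl aT).
- by move=> v; rewrite (act1l aG) (act1l aP).
- by move=> p q v; rewrite (actDl aG).
- by move=> p q v; rewrite (actMl aG).
- by move=> a p v; rewrite (actZl aG).
Qed.

Definition fprod_act (h : Defs.fprod R) (v : V) : V := term_act (repr h) v.

Lemma fprod_act_class x : fprod_act (fclass R x) =1 term_act x.
Proof. exact/fcong_act/frepr_class. Qed.

Lemma fprod_actD h h' v : fprod_act (h + h') v = fprod_act h v + fprod_act h' v.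
Proof.
rewrite -(fclass_repr h) -(fclass_repr h') -[_ + _]/(fprod_add _ _) fclassD.
by rewrite !fprod_act_class.
Qed.
Lemma fprod_actM h h' v : fprod_act (h * h') v = fprod_act h (fprod_act h' v).
Proof.
rewrite -(fclass_repr h) -(fclass_repr h') -[_ * _]/(fprod_mul _ _) fclassM.
by rewrite !fprod_act_class.
Qed.
Lemma fprod_actZ c h v : fprod_act (c *: h) v = c *: fprod_act h v.
Proof.
by rewrite -(fclass_repr h) -[_ *: _]/(fprod_scale _ _) fclassZ !fprod_act_class.
Qed.

End FreeProductAction.

Lemma fprod_ind (k : comNzRingType) (P T G : algType k)
    (R : fterm P T G -> fterm P T G -> Prop) (Q : Defs.fprod R -> Prop) :
  (forall p, Q (fprod_inP R p)) -> (forall t, Q (fprod_inT R t)) ->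
  (forall g, Q (fprod_inG R g)) ->
  (forall x y, Q x -> Q y -> Q (x + y)) -> (forall x y, Q x -> Q y -> Q (x * y)) ->
  (forall c x, Q x -> Q (c *: x)) -> forall h, Q h.
Proof.
move=> QP QT QG QD QM QZ h; rewrite -(fclass_repr h).
elim: (repr h) => [p|t|g|x IHx y IHy|x IHx y IHy|c x IHx].
- exact: QP.
- exact: QT.
- exact: QG.
- by rewrite -fclassD; apply: QD.
- by rewrite -fclassM; apply: QM.
- by rewrite -fclassZ; apply: QZ.
Qed.

Section MpolyAction.
Variables (k : comNzRingType) (n : nat) (V : lmodType k).
Variable Z : 'I_n -> V -> V.
Hypothesis Zlin : forall i, linear (Z i).
Hypothesis Zcomm : forall i j v, Z i (Z j v) = Z j (Z i v).

Definition mnm_act (m : 'X_{1..n}) (v : V) : V :=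
  foldr (fun i u => iter (m i) (Z i) u) v (enum 'I_n).

Lemma iterZ_comm a b i j v : iter a (Z i) (iter b (Z j) v) = iter b (Z j) (iter a (Z i) v).
Proof.
elim: a => //= a ->; elim: b {a} (iter a _ _) => //= b IHb u.
by rewrite Zcomm IHb.
Qed.

Lemma mnm_actD m m' v : mnm_act (m + m')%MM v = mnm_act m (mnm_act m' v).
Proof.
rewrite /mnm_act; elim: (enum 'I_n) => //= i s IHs; rewrite mnmDE iterD {}IHs.
congr iter; move: (foldr _ v s) => u.
by elim: s => //= j s IHs; rewrite -IHs iterZ_comm.
Qed.

Lemma mnm_act0 v : mnm_act 0%MM v = v.
Proof. by rewrite /mnm_act; elim: (enum 'I_n) => //= i s ->; rewrite mnmE. Qed.

Lemma mnm_act1 i v : mnm_act U_(i)%MM v = Z i v.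
Proof.
rewrite /mnm_act.
suff /(_ (enum_uniq _)) : uniq (enum 'I_n) ->
  foldr (fun j u => iter (U_(i)%MM j) (Z j) u) v (enum 'I_n)
    = if i \in enum 'I_n then Z i v else v by rewrite mem_enum.
elim: (enum 'I_n) => //= j s IHs /andP[js us]; rewrite (IHs us) in_cons mnm1E.
by have [->|ne] := eqVneq i j; first rewrite (negPf js).
Qed.

Lemma mnm_act_lin m : linear (mnm_act m).
Proof.
move=> c u v; rewrite /mnm_act; elim: (enum 'I_n) => //= i s ->.
elim: (m i) (foldr _ u s) (foldr _ v s) => //= a IHa u' v'.
by rewrite IHa Zlin.
Qed.
HB.instance Definition _ m :=
  GRing.isLinear.Build k V V *:%R (mnm_act m) (mnm_act_lin m).

Definition mpoly_act (p : {mpoly k[n]}) (v : V) : V :=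
  \sum_(m <- msupp p) p@_m *: mnm_act m v.

Lemma mpoly_actE d p v : (msize p <= d)%N ->
  mpoly_act p v = \sum_(m : 'X_{1..n < d}) p@_m *: mnm_act m v.
Proof.
move=> led; pose I : subFinType _ := 'X_{1..n < d}.
rewrite /mpoly_act (big_mksub I) ?msupp_uniq //=; last first.
  by move=> m /msize_mdeg_lt /leq_trans; apply.
by rewrite big_rmcond //= => m /memN_msupp_eq0 ->; rewrite scale0r.
Qed.

Lemma mpoly_act_linl c p q v : mpoly_act (c *: p + q) v = c *: mpoly_act p v + mpoly_act q v.
Proof.
pose d := maxn (msize (c *: p + q)) (maxn (msize p) (msize q)).
rewrite !(@mpoly_actE d) ?leq_max ?leqnn ?orbT //.
rewrite scaler_sumr -big_split; apply: eq_bigr => m _.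
by rewrite mcoeffD mcoeffZ scalerDl scalerA.
Qed.

Lemma mpoly_actX m v : mpoly_act 'X_[m] v = mnm_act m v.
Proof. by rewrite /mpoly_act msuppX big_seq1 mcoeffX eqxx scale1r. Qed.

Lemma mpoly_actXU i v : mpoly_act 'X_i v = Z i v.
Proof. by rewrite mpoly_actX mnm_act1. Qed.

Lemma mpoly_act_action : alg_action mpoly_act.
Proof.
have lin p : linear (mpoly_act p).
  move=> c u v; rewrite /mpoly_act scaler_sumr -big_split; apply: eq_bigr => m _.
  by rewrite /= linearP scalerDr !scalerA mulrC.
have aD p q v : mpoly_act (p + q) v = mpoly_act p v + mpoly_act q v.
  by have := mpoly_act_linl 1 p q v; rewrite !scale1r.
have a0 v : mpoly_act 0 v = 0 by rewrite /mpoly_act msupp0 big_nil.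
have aZ c p v : mpoly_act (c *: p) v = c *: mpoly_act p v.
  by have := mpoly_act_linl c p 0 v; rewrite a0 !addr0.
split => // [p q v|v]; last first.
  by rewrite -mpolyX0 mpoly_actX mnm_act0.
have aS (I : eqType) (s : seq I) (c : I -> k) (r : I -> {mpoly k[n]}) u :
    mpoly_act (\sum_(i <- s) c i *: r i) u = \sum_(i <- s) c i *: mpoly_act (r i) u.
  elim: s => [|i s IHs]; first by rewrite !big_nil.
  by rewrite !big_cons aD aZ IHs.
rewrite {1}[p]mpolyE mulr_suml.
under eq_bigr => m _ do rewrite -scalerAl.
rewrite aS [RHS]/mpoly_act; apply: eq_bigr => m _; congr (_ *: _).
rewrite {1}[q]mpolyE mulr_sumr.
under eq_bigr => m' _ do rewrite -scalerAr -mpolyXD.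
rewrite aS [mpoly_act q v]/mpoly_act linear_sum; apply: eq_bigr => m' _.
by rewrite linearZ /= mpoly_actX mnm_actD.
Qed.

End MpolyAction.

Section SymAction.
Variables (k : comNzRingType) (n : nat) (V : lmodType k) (W : 'S_n -> V -> V).
Hypotheses (Wlin : forall w, linear (W w)) (W1 : forall v, W 1%g v = v).
Hypothesis (WM : forall u w v, W (w * u)%g v = W u (W w v)).
HB.instance Definition _ w := GRing.isLinear.Build k V V *:%R (W w) (Wlin w).

Definition sym_act (g : symalg k n) (v : V) : V := \sum_w (g w : k) *: W w v.

Lemma sym_act_elt w v : sym_act (symelt k w) v = W w v.
Proof.
rewrite /sym_act (bigD1 w) //= ffunE eqxx scale1r big1 ?addr0 // => u ne.
by rewrite ffunE (negPf ne) scale0r.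
Qed.

Lemma sym_act_action : alg_action sym_act.
Proof.
split=> [g c u v|g h v|c g v|g h v|v].
- rewrite /sym_act scaler_sumr -big_split; apply: eq_bigr => w _.
  by rewrite linearP scalerDr !scalerA mulrC.
- by rewrite /sym_act -big_split; apply: eq_bigr => w _; rewrite ffunE scalerDl.
- by rewrite /sym_act scaler_sumr; apply: eq_bigr => w _; rewrite ffunE scalerA.
- rewrite /sym_act.
  under eq_bigr => w _ do rewrite [(g * h) w]skew_mulE scaler_suml.
  rewrite exchange_big /=; apply: eq_bigr => u _.
  rewrite linear_sum scaler_sumr (reindex_inj (mulIg u)) /=.
  by apply: eq_bigr => w _; rewrite mulgK WM linearZ /= scalerA.
- by rewrite -[1]/(symelt k 1%g) sym_act_elt W1.
Qed.

End SymAction.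

Section AffinizationAction.
Variables (k : comNzRingType) (A : freeAlgType k) (n : nat) (V : lmodType k).
Variables (phi : {linear A -> 'Hom(A, k^o)}) (psi : 'Hom(A, k^o) -> A).
Local Notation B := (tpow A n).
Local Notation Delta := (@Delta k A phi psi n).
Variables (Z : 'I_n -> V -> V) (fT : B -> V -> V) (W : 'S_n -> V -> V).
Local Notation c_ := (fun i i' j : 'I_n => (i == j)%:R - (i' == j)%:R : k).

Record affine_action : Prop := AffineAction {
  aa_Zlin : forall i, linear (Z i);
  aa_Zcomm : forall i j v, Z i (Z j v) = Z j (Z i v);
  aa_T : alg_action fT;
  aa_Wlin : forall w, linear (W w);
  aa_W1 : forall v, W 1%g v = v;
  aa_WM : forall u w v, W (w * u)%g v = W u (W w v);
  aa_TZ : forall a j v, fT a (Z j v) = Z j (fT a v);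
  aa_WT : forall (i i' : 'I_n) a v, i' = i.+1 :> nat ->
    W (tperm i i') (fT a v) = fT (tplace (tperm i i') a) (W (tperm i i') v);
  aa_WZ : forall (i i' j : 'I_n) v, i' = i.+1 :> nat ->
    W (tperm i i') (Z j v) =
    Z (tperm i i' j) (W (tperm i i') v) + c_ i i' j *: fT (Delta i i') v }.

Hypothesis aa : affine_action.

Local Notation fP := (mpoly_act Z).
Local Notation fG := (sym_act W).
Let aP : alg_action fP := mpoly_act_action (aa_Zlin aa) (aa_Zcomm aa).
Let aG : alg_action fG := sym_act_action (aa_Wlin aa) (aa_W1 aa) (aa_WM aa).

Lemma aff_rel_act x y : aff_rel phi psi x y -> term_act fP fT fG x =1 term_act fP fT fG y.
Proof.
case=> {x y} [a j|i i' a ei|i i' j ei] v /=.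
- by rewrite !mpoly_actXU (aa_TZ aa).
- by rewrite !sym_act_elt (aa_WT aa).
- rewrite !sym_act_elt !mpoly_actXU (aa_WZ aa _ _ ei) scaleN1r.
  by rewrite addrAC subrr add0r -(actZl (aa_T aa)).
Qed.

Definition aff_act (h : affinization n phi psi) (v : V) : V := fprod_act fP fT fG h v.

Lemma aff_actDl h h' v : aff_act (h + h') v = aff_act h v + aff_act h' v.
Proof. exact: fprod_actD aP (aa_T aa) aG aff_rel_act _ _ _. Qed.
Lemma aff_actMl h h' v : aff_act (h * h') v = aff_act h (aff_act h' v).
Proof. exact: fprod_actM aP (aa_T aa) aG aff_rel_act _ _ _. Qed.
Lemma aff_actZl c h v : aff_act (c *: h) v = c *: aff_act h v.
Proof. exact: fprod_actZ aP (aa_T aa) aG aff_rel_act _ _ _. Qed.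
Lemma aff_act_poly p v : aff_act (aff_poly phi psi p) v = fP p v.
Proof. exact: fprod_act_class aP (aa_T aa) aG aff_rel_act _ _. Qed.
Lemma aff_act_tens a v : aff_act (aff_tens phi psi a) v = fT a v.
Proof. exact: fprod_act_class aP (aa_T aa) aG aff_rel_act _ _. Qed.
Lemma aff_act_sym g v : aff_act (aff_sym phi psi g) v = fG g v.
Proof. exact: fprod_act_class aP (aa_T aa) aG aff_rel_act _ _. Qed.

End AffinizationAction.

(* S_n permutes the commutators [Z_j, Z_l] whether or not they vanish, so it is
   enough to kill them on a generating subspace, or for a single j. *)
Section Commutators.
Variables (k : comNzRingType) (n : nat) (V : lmodType k).
Variables (Z : 'I_n -> V -> V) (W : 'S_n -> V -> V) (D : 'I_n -> 'I_n -> V -> V).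
Hypotheses (Zlin : forall i, linear (Z i)) (Wlin : forall w, linear (W w)).
Hypothesis DZ : forall i i' j v, D i i' (Z j v) = Z j (D i i' v).
Hypothesis WZ : forall (i i' j : 'I_n) v, i' = i.+1 :> nat ->
    W (tperm i i') (Z j v) = Z (tperm i i' j) (W (tperm i i') v)
      + ((i == j)%:R - (i' == j)%:R : k) *: D i i' v.

Definition zcomm j l v := Z j (Z l v) - Z l (Z j v).

Lemma zcomm_adjacent (i i' j l : 'I_n) v : i' = i.+1 :> nat ->
  W (tperm i i') (zcomm j l v) = zcomm (tperm i i' j) (tperm i i' l) (W (tperm i i') v).
Proof.
move=> ei; rewrite /zcomm.
pose f i := HB.pack_for {linear V -> V} (Z i) (GRing.isLinear.Build _ _ _ _ _ (Zlin i)).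
pose g w := HB.pack_for {linear V -> V} (W w) (GRing.isLinear.Build _ _ _ _ _ (Wlin w)).
rewrite -![W _ _]/(g _ _) linearB /= !WZ //.
set c := fun x => (i == x)%:R - (i' == x)%:R : k.
rewrite -/(c j) -/(c l) -![Z (tperm i i' _) (_ + _)]/(f _ _) !linearD !linearZ /= !DZ.
set u := D i i' v.
have Zs x : Z (tperm i i' x) u = Z x u - c x *: (Z i u - Z i' u).
  rewrite /c; case: tpermP => [->|->|/eqP ni /eqP ni'].
  - by rewrite eqxx -[i' == i]val_eqE /= ei gtn_eqF // subr0 scale1r opprB addrC subrK.
  - by rewrite eqxx -[i == i']val_eqE /= ei ltn_eqF // sub0r scaleN1r opprK addrC subrK.
  - by rewrite eq_sym (negPf ni) eq_sym (negPf ni') subrr scale0r subr0.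
have -> : Z (tperm i i' j) (Z (tperm i i' l) (W (tperm i i') v))
    + c l *: Z (tperm i i' j) u + c j *: Z l u
  = Z (tperm i i' j) (Z (tperm i i' l) (W (tperm i i') v))
    + (c j *: Z (tperm i i' l) u + c l *: Z j u).
  rewrite -addrA; congr (_ + _); rewrite !Zs !scalerBr !scalerA [c l * c j]mulrC.
  by rewrite addrAC [RHS]addrAC; congr (_ - _); rewrite addrC.
by rewrite !scalerN -[X in _ + X = _]addrA -opprD addrACA subrr addr0.
Qed.

Hypotheses (W1 : forall v, W 1%g v = v) (WM : forall u w v, W (w * u)%g v = W u (W w v)).

Lemma zcomm_perm (w : 'S_n) j l v : W w (zcomm j l v) = zcomm (w j) (w l) (W w v).
Proof.
elim/perm_adjacent_ind: w => [|i i' w ei IHw]; first by rewrite !W1 !perm1.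
by rewrite !WM IHw (zcomm_adjacent _ _ _ ei) !permM.
Qed.

Lemma zcomm_perm0 (w : 'S_n) j l v : zcomm (w j) (w l) (W w v) = 0 -> zcomm j l v = 0.
Proof.
rewrite -zcomm_perm => /(congr1 (W (w^-1)%g)); rewrite -WM mulgV W1 => ->.
by have := Wlin (w^-1)%g (-1) 0 0; rewrite scaler0 addr0 scaleN1r addNr.
Qed.

Lemma zcomm_zero o j l v : (forall u, Z o u = 0) -> zcomm j l v = 0.
Proof.
move=> Zo; apply: (zcomm_perm0 (w := tperm j o)); rewrite /zcomm tpermL !Zo.
set m := tperm j o l; have -> : Z m 0 = 0; last exact: subrr.
by have := Zlin m (-1) 0 0; rewrite scaler0 addr0 scaleN1r addNr.
Qed.

End Commutators.

(** * Polynomials *)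

Lemma mpoly_gen_ind (k : comNzRingType) (n : nat) (P : {mpoly k[n]} -> Prop) :
  P 1 -> (forall i, P 'X_i) ->
  (forall c p q, P p -> P q -> P (c *: p + q)) ->
  (forall p q, P p -> P q -> P (p * q)) -> forall p, P p.
Proof.
move=> P1 PX PL PM p.
have P0 : P 0 by rewrite -(subrr 1) addrC -scaleN1r; apply: PL.
rewrite [p]mpolyE; apply: (big_ind P) => // [x y Px Py|m _].
  by rewrite -[x]scale1r; apply: PL.
rewrite -[_ *: _]addr0; apply: PL => //; rewrite mpolyXE_id.
apply: (big_ind P) => // i _; elim: (m i) => [|a IHa]; first by rewrite expr0.
by rewrite exprS; apply: PM.
Qed.

Lemma msize_le_coeff (k : comNzRingType) (n : nat) (p : {mpoly k[n]}) D :
  (forall m, (D <= mdeg m)%N -> p@_m = 0) -> (msize p <= D)%N.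
Proof.
move=> h; rewrite msizeE; apply/bigmax_leqP_seq => m pm _.
by rewrite ltnNge; apply: contraL pm => /h e; rewrite mcoeff_msupp e eqxx.
Qed.

Lemma msize_msym (k : comNzRingType) (n : nat) (w : 'S_n) (p : {mpoly k[n]}) : (msize (msym w p) <= msize p)%N.
Proof.
apply: msize_le_coeff => m lem; rewrite mcoeff_sym; apply: memN_msupp_eq0.
by apply: msize_mdeg_ge; rewrite mdeg_mperm.
Qed.

Lemma msizeXM_le (k : comNzRingType) (n : nat) m (p : {mpoly k[n]}) : (msize ('X_[m] * p) <= msize p + mdeg m)%N.
Proof.
rewrite msizeE; apply/bigmax_leqP_seq => m' + _; rewrite mulrC (perm_mem (msuppMX p m)).
by case/mapP=> m'' pm ->; rewrite mdegD addnC -addSn leq_add2r msize_mdeg_lt.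
Qed.

Lemma msymXU (k : comNzRingType) (n : nat) (w : 'S_n) i : msym w 'X_i = 'X_(w i) :> {mpoly k[n]}.
Proof.
rewrite msymX; congr 'X_[_]; apply/mnmP => j.
by rewrite mnmE !mnm1E (can2_eq (permK w) (permKV w)).
Qed.

Lemma msize_XB (k : comNzRingType) (n : nat) (i j : 'I_n) (p : {mpoly k[n]}) D : i != j ->
  (msize (('X_i - 'X_j) * p) <= D)%N -> (msize p <= D.-1)%N.
Proof.
move=> nij le; apply: msize_le_coeff => m lem.
have {}le m' : (D <= mdeg m')%N -> (p * 'X_i)@_m' = (p * 'X_j)@_m'.
  move=> lem'; apply/eqP; rewrite -subr_eq0 -mcoeffB -mulrBr mulrC; apply/eqP.
  by apply/memN_msupp_eq0/msize_mdeg_ge/(leq_trans le).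
move: {2}(m j) (erefl (m j)) lem => c; elim: c m => [|c IHc] m mj lem.
  rewrite -(mcoeffMX p U_(i)%MM m) le; last by rewrite mdegD mdeg1 add1n; apply: leq_trans (leqSpred D) _.
  apply/memN_msupp_eq0; rewrite (perm_mem (msuppMX p _)); apply/mapP => -[m' _].
  move/(congr1 (fun m : 'X_{1..n} => m j)).
  by rewrite !mnmDE !mnm1E mj eqxx (negPf nij).
pose m' := (m - U_(j))%MM.
have em : m = (U_(j) + m')%MM.
  by rewrite addmC submK //; apply/mnm_lepP => l; rewrite mnm1E; case: eqP => // <-; rewrite mj.
rewrite -(mcoeffMX p U_(i)%MM m) le; last by rewrite mdegD mdeg1 add1n; apply: leq_trans (leqSpred D) _.
rewrite em addmC -addmA mcoeffMX; apply: IHc.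
  by move: mj; rewrite em !mnmDE !mnm1E eqxx (negPf nij) add1n addn0 => -[].
by move: lem; rewrite em !mdegD !mdeg1 addnC.
Qed.

(** * Normal forms and freeness *)

Lemma free_left_of_coord (S H : pzRingType) (iota : S -> H) (I : eqType) (b : I -> H)
    (Q : zmodType) (psi : {additive Q -> H}) (g : I -> S -> Q)
    (coord : I -> {additive Q -> S}) :
  injective psi -> (forall h, exists q, h = psi q) ->
  (forall i c, psi (g i c) = iota c * b i) ->
  (forall i j c, coord i (g j c) = if i == j then c else 0) ->
  (forall q, exists s : seq I, q = \sum_(i <- s) g i (coord i q)) ->
  free_left iota.
Proof.
move=> inj surj psiE coordE span; exists I, b; split=> [h|s c us e i si].
  have [q ->] := surj h; have [s {1}->] := span q.
  exists s, (coord^~ q); rewrite raddf_sum; apply: eq_bigr => i _; exact: psiE.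
have /inj e0 : psi (\sum_(i <- s) g i (c i)) = psi 0.
  by rewrite raddf0 -[RHS]e raddf_sum; apply: eq_bigr => j _; rewrite psiE.
rewrite -(raddf0 (coord i)) -e0 raddf_sum (bigD1_seq i) //= coordE eqxx.
by rewrite big1 ?addr0 // => j nj; rewrite coordE eq_sym (negPf nj).
Qed.

Lemma free_right_of_coord (S H : pzRingType) (iota : S -> H) (I : eqType) (b : I -> H)
    (Q : zmodType) (psi : {additive Q -> H}) (g : I -> S -> Q)
    (coord : I -> {additive Q -> S}) :
  injective psi -> (forall h, exists q, h = psi q) ->
  (forall i c, psi (g i c) = b i * iota c) ->
  (forall i j c, coord i (g j c) = if i == j then c else 0) ->
  (forall q, exists s : seq I, q = \sum_(i <- s) g i (coord i q)) ->
  free_right iota.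
Proof.
move=> inj surj psiE coordE span; exists I, b; split=> [h|s c us e i si].
  have [q ->] := surj h; have [s {1}->] := span q.
  exists s, (coord^~ q); rewrite raddf_sum; apply: eq_bigr => i _; exact: psiE.
have /inj e0 : psi (\sum_(i <- s) g i (c i)) = psi 0.
  by rewrite raddf0 -[RHS]e raddf_sum; apply: eq_bigr => j _; rewrite psiE.
rewrite -(raddf0 (coord i)) -e0 raddf_sum (bigD1_seq i) //= coordE eqxx.
by rewrite big1 ?addr0 // => j nj; rewrite coordE eq_sym (negPf nj).
Qed.

Section PolyModule.
Variables (k : comNzRingType) (A : freeAlgType k) (n : nat).
Local Notation B := (tpow A n).
Local Notation M := (polytens A n).

Definition poly_mul (f : {mpoly k[n]}) (x : M) : M := [ffun I => f * x I].

Lemma poly_mulP f : linear (poly_mul f).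
Proof. by move=> c x y; apply/ffunP => I; rewrite !ffunE mulrDr scalerAr. Qed.
HB.instance Definition _ f :=
  GRing.isLinear.Build k M M *:%R (poly_mul f) (poly_mulP f).

Lemma poly_mul_linl c f g x : poly_mul (c *: f + g) x = c *: poly_mul f x + poly_mul g x.
Proof. by apply/ffunP => I; rewrite !ffunE mulrDl scalerAl. Qed.
Lemma poly_mulM f g x : poly_mul (f * g) x = poly_mul f (poly_mul g x).
Proof. by apply/ffunP => I; rewrite !ffunE mulrA. Qed.
Lemma poly_mul1 x : poly_mul 1 x = x.
Proof. by apply/ffunP => I; rewrite !ffunE mul1r. Qed.
Lemma poly_lmul f b x : poly_mul f (tens_lmul b x) = tens_lmul b (poly_mul f x).
Proof.
apply/ffunP => I; rewrite !ffunE mulr_sumr; apply: eq_bigr => J _.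
by rewrite ffunE scalerAr.
Qed.

Definition tens_one : M := mtens (1 : {mpoly k[n]}) (fun=> 1).

Lemma tens_one_coord (f : {mpoly k[n]}) (b : B) I :
  poly_mul f (tens_lmul b tens_one) I = (b I : k) *: f.
Proof. by rewrite ffunE tens_lmul_oneE -scalerAr mulr1. Qed.

End PolyModule.

Section RegularRepresentation.
Variables (k : comNzRingType) (A : freeAlgType k) (gr : int -> A -> Prop) (d : int).
Variables (phi : {linear A -> 'Hom(A, k^o)}) (psi : 'Hom(A, k^o) -> A) (n : nat).
Hypothesis sym : graded_symmetric gr d phi psi.
Local Notation B := (tpow A n).
Local Notation M := (polytens A n).
Local Notation Q := (polytens_sym A n).
Local Notation Delta := (@Delta k A phi psi n).
Local Notation inv w := (w^-1 : 'S_n)%g.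

Definition single (w : 'S_n) (x : M) : Q := [ffun u => if u == w then x else 0].

Lemma single_lin w : linear (single w).
Proof.
by move=> c x y; apply/ffunP => u; rewrite !ffunE; case: eqP; rewrite ?scaler0 ?addr0.
Qed.
HB.instance Definition _ w := GRing.isLinear.Build k M Q *:%R (single w) (single_lin w).

Lemma single_sum (q : Q) : q = \sum_w single w (q w).
Proof.
apply/ffunP => w; rewrite sum_ffunE (bigD1 w) //= ffunE eqxx big1 ?addr0 // => u ne.
by rewrite ffunE eq_sym (negPf ne).
Qed.

Definition repT (a : B) (q : Q) : Q :=
  [ffun w => tens_lmul (tplace (inv w) a) (q w)].

Definition repW (u : 'S_n) (q : Q) : Q := [ffun w => q (w * u^-1)%g].

(* Nonzero if w^-1 keeps the order of j and t, i.e. if v^-1 reverses it for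
   v = (t j) o w. *)
Definition inv_sign (w : 'S_n) (j t : 'I_n) : k :=
  ((j < t)%N && ((inv w) j < (inv w) t)%N)%:R
  - ((t < j)%N && ((inv w) t < (inv w) j)%N)%:R.

Definition repZ (j : 'I_n) (q : Q) : Q :=
  [ffun w => poly_mul 'X_((inv w) j) (q w) +
     \sum_t inv_sign w j t *:
       tens_lmul (Delta ((inv w) j) ((inv w) t)) (q (w * tperm t j)%g)].

Lemma repT_lin a : linear (repT a).
Proof. by move=> c x y; apply/ffunP => w; rewrite !ffunE linearP. Qed.
Lemma repW_lin u : linear (repW u).
Proof. by move=> c x y; apply/ffunP => w; rewrite !ffunE. Qed.
Lemma repZ_lin j : linear (repZ j).
Proof.
move=> c x y; apply/ffunP => w; rewrite !ffunE linearP scalerDr.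
rewrite -!addrA; congr (_ + _); rewrite addrCA; congr (_ + _).
rewrite scaler_sumr -big_split; apply: eq_bigr => t _.
by rewrite /= !ffunE linearP scalerDr !scalerA mulrC.
Qed.
HB.instance Definition _ a := GRing.isLinear.Build k Q Q *:%R (repT a) (repT_lin a).
HB.instance Definition _ u := GRing.isLinear.Build k Q Q *:%R (repW u) (repW_lin u).
HB.instance Definition _ j := GRing.isLinear.Build k Q Q *:%R (repZ j) (repZ_lin j).

Lemma repT_action : alg_action repT.
Proof.
split=> [|a b v|c a v|a b v|v].
- exact: repT_lin.
- by apply/ffunP => w; rewrite !ffunE linearD tens_lmulDl.
- by apply/ffunP => w; rewrite !ffunE linearZ tens_lmulZl.
- by apply/ffunP => w; rewrite !ffunE tplaceM tens_lmulM.
- by apply/ffunP => w; rewrite !ffunE tplace_one tens_lmul1.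
Qed.

Lemma repW1 v : repW 1%g v = v.
Proof. by apply/ffunP => w; rewrite ffunE invg1 mulg1. Qed.
Lemma repWM u w v : repW (w * u)%g v = repW u (repW w v).
Proof. by apply/ffunP => x; rewrite !ffunE invMg mulgA. Qed.
Lemma repW_single u w x : repW u (single w x) = single (w * u)%g x.
Proof.
apply/ffunP => v; rewrite !ffunE.
by rewrite (can2_eq (mulgKV u) (mulgK u)).
Qed.

Lemma inv_signjj w j : inv_sign w j j = 0.
Proof. by rewrite /inv_sign !ltnn subrr. Qed.

Lemma repTZ a j v : repT a (repZ j v) = repZ j (repT a v).
Proof.
apply/ffunP => w; rewrite !ffunE linearD /= -poly_lmul; congr (_ + _).
rewrite linear_sum; apply: eq_bigr => t _; rewrite linearZ /= ffunE.
have [->|ne] := eqVneq t j; first by rewrite inv_signjj !scale0r.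
congr (_ *: _); rewrite -!tens_lmulM; congr (tens_lmul _ _).
rewrite (Delta_comm sym); last by rewrite (inj_eq perm_inj) eq_sym.
congr (_ * _); rewrite tplace_comp; congr (tplace _ a).
rewrite invMg tpermV.
have -> : tperm ((inv w) j) ((inv w) t) = (w * tperm j t * w^-1)%g.
  by rewrite -tpermJ conjgE invgK mulgA.
by rewrite !mulgA mulgVK tpermC tperm2 mul1g.
Qed.

Lemma repWT (i i' : 'I_n) a v :
  repW (tperm i i') (repT a v) = repT (tplace (tperm i i') a) (repW (tperm i i') v).
Proof.
apply/ffunP => w; rewrite !ffunE tplace_comp tpermV; congr (tens_lmul (tplace _ _) _).
by rewrite invMg tpermV.
Qed.

Lemma tperm_adjacentE (i i' t : 'I_n) : i' = i.+1 :> nat ->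
  nat_of_ord (tperm i i' t) =
  (if t == i :> nat then i.+1 else if t == i.+1 :> nat then nat_of_ord i else t).
Proof.
move=> ei; case: tpermP => [->|->|nt nt']; first by rewrite eqxx ei.
  by rewrite ei gtn_eqF // eqxx.
by rewrite -ei !ifN //; apply/eqP => e; [apply: nt'|apply: nt]; apply/val_inj.
Qed.

Lemma ltn_tperm_adjacent (i i' j t : 'I_n) : i' = i.+1 :> nat ->
  ~~ ((t == tperm i i' j) && (t != j)) ->
  (tperm i i' j < tperm i i' t)%N = (j < t)%N.
Proof.
move=> ei; rewrite -!val_eqE /= !tperm_adjacentE //.
by do !case: eqP; lia.
Qed.

Lemma repWZ (i i' j : 'I_n) v : i' = i.+1 :> nat ->
  repW (tperm i i') (repZ j v) = repZ (tperm i i' j) (repW (tperm i i') v)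
    + ((i == j)%:R - (i' == j)%:R : k) *: repT (Delta i i') v.
Proof.
move=> ei; set s := tperm i i'; apply/ffunP => w.
have sV : (s^-1 = s)%g by apply: tpermV.
have wsV x : ((w * s)^-1)%g x = (inv w) (s x) by rewrite invMg sV permM.
have lt1 : (i < i')%N by rewrite ei.
have lt2 : (i' < i)%N = false by rewrite ei ltnNge leqnSn.
have nii : i != i' by rewrite -val_eqE /= ltn_eqF.
have nii1 := negPf nii; have nii2 : (i' == i) = false by rewrite eq_sym.
rewrite !ffunE sV wsV -addrA; congr (_ + _).
rewrite [in RHS](reindex_inj (@perm_inj _ s)) /=.
under [LHS]eq_bigr => t _.
  rewrite wsV; have -> : (w * s * tperm t j = w * tperm (s t) (s j) * s)%g.
    rewrite -!mulgA; congr (_ * _)%g.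
    by rewrite -tpermJ conjgE sV -!mulgA /s tperm2 mulg1.
  over.
under [in RHS]eq_bigr => t _ do rewrite ffunE sV.
pose c t := inv_sign (w * s)%g j t - inv_sign w (s j) (s t).
pose E t : M := tens_lmul (Delta ((inv w) (s j)) ((inv w) (s t)))
  (v (w * tperm (s t) (s j) * s)%g).
suff h : \sum_t c t *: E t = ((i == j)%:R - (i' == j)%:R : k)
    *: tens_lmul (tplace (inv w) (Delta i i')) (v w).
  rewrite -{}h -big_split /=; apply: eq_bigr => t _.
  by rewrite -scalerDl /c addrC subrK.
rewrite (tplace_Delta sym) //.
have cE t : c t = if (t == s j) && (t != j) then (i == j)%:R - (i' == j)%:R else 0.
  case: ifPn => [/andP[/eqP -> nj]|nt]; last first.
    rewrite /c /inv_sign !wsV !ltn_tperm_adjacent ?subrr // eq_sym.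
    by move: nt; rewrite (can2_eq (tpermK _ _) (tpermK _ _)) eq_sym [j == t]eq_sym.
  have njs : s j != j by [].
  rewrite /c /inv_sign !wsV; have := inj_eq (@perm_inj _ (inv w)) (s (s j)) (s j).
  move: nj; rewrite /s tpermK; case: tpermP => [->|->|/eqP n1 /eqP n2]; last by rewrite eqxx.
  - move=> _; rewrite lt1 lt2 nii1 nii2 eqxx /= -val_eqE /=.
    by case: ltngtP => // _ _; rewrite ?subr0 ?sub0r ?opprK ?add0r.
  - move=> _; rewrite lt1 lt2 nii1 nii2 eqxx /= -val_eqE /=.
    by case: ltngtP => // _ _; rewrite ?subr0 ?sub0r ?oppr0 ?addr0.
have [ej|nj] := boolP (s j != j).
  rewrite (bigD1 (s j)) //= cE eqxx ej big1 => [|t nt]; last first.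
    by rewrite cE (negPf nt) scale0r.
  rewrite addr0 /E /s tpermK; case: tpermP ej => [->|->|/eqP n1 /eqP n2]; last by rewrite eqxx.
  - by move=> _; rewrite -mulgA tperm2 mulg1 (DeltaC sym) // (inj_eq perm_inj) eq_sym.
  - by move=> _; rewrite [tperm i' i]tpermC -mulgA tperm2 mulg1.
rewrite big1 => [|t _].
  have -> : (i == j) = false.
    by apply: contraNF nj => /eqP <-; rewrite /s tpermL eq_sym.
  have -> : (i' == j) = false.
    by apply: contraNF nj => /eqP <-; rewrite /s tpermR.
  by rewrite subrr scale0r.
by rewrite cE; move: nj; rewrite negbK => /eqP ->; rewrite andbN scale0r.
Qed.

Lemma repZ_single1 j x : repZ j (single 1%g x) = single 1%g (poly_mul 'X_j x).
Proof.
apply/ffunP => w; rewrite !ffunE big1 => [|t _].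
  by case: eqP => [->|_]; rewrite ?linear0 addr0 // invg1 perm1.
rewrite ffunE; case: eqP => [e|_]; last by rewrite linear0 scaler0.
have -> : w = tperm t j by rewrite -[w](mulgK (tperm t j)) e mul1g tpermV.
rewrite /inv_sign tpermV tpermL tpermR.
by case: ltngtP => _; rewrite subrr scale0r.
Qed.

Lemma repZ_comm j l q : repZ j (repZ l q) = repZ l (repZ j q).
Proof.
apply/eqP; rewrite -subr_eq0 [q]single_sum !linear_sum. rewrite -big_split /=.
rewrite big1 // => w _; move: (q w) => x {q}.
have -> : single w x = repW w (single 1%g x) by rewrite repW_single mul1g.
apply: (zcomm_perm0 (W := repW) (D := fun i i' => repT (Delta i i')) (w := inv w)
  repZ_lin repW_lin (fun i i' => repTZ (Delta i i')) (fun i i' j v => @repWZ i i' j v) repW1 repWM).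
by rewrite -repWM mulgV repW1 /zcomm !repZ_single1 -!poly_mulM [_ * _]mulrC subrr.
Qed.

Lemma rep_affine : affine_action phi psi repZ repT repW.
Proof.
split.
- exact: repZ_lin.
- exact: repZ_comm.
- exact: repT_action.
- exact: repW_lin.
- exact: repW1.
- exact: repWM.
- exact: repTZ.
- by move=> i i' a v _; apply: repWT.
- exact: repWZ.
Qed.

Lemma mpoly_act_single1 p x : mpoly_act repZ p (single 1%g x) = single 1%g (poly_mul p x).
Proof.
have act := mpoly_act_action repZ_lin repZ_comm.
elim/mpoly_gen_ind: p x => [|i|c p q IHp IHq|p q IHp IHq] x.
- by rewrite (act1l act) poly_mul1.
- by rewrite mpoly_actXU repZ_single1.
- by rewrite (actDl act) (actZl act) IHp IHq poly_mul_linl linearP.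
- by rewrite (actMl act) IHq IHp poly_mulM.
Qed.

Local Notation H := (affinization n phi psi).
Local Notation hP := (aff_poly (A := A) (n := n) phi psi).
Local Notation hT := (aff_tens (n := n) phi psi).
Local Notation hG := (aff_sym (A := A) (n := n) phi psi).
Local Notation hW w := (hG (symelt k w)).
Local Notation embed := (@aff_embed k A n phi psi).
Local Notation e_ I := (pure (tbasis (A := A) I) : B).

Lemma aff_scaleAl c (x y : H) : c *: (x * y) = (c *: x) * y.
Proof. exact: fprod_scaleAl. Qed.
Lemma aff_scaleAr c (x y : H) : c *: (x * y) = x * (c *: y).
Proof. exact: fprod_scaleAr. Qed.

Lemma aff_polyD p q : hP (p + q) = hP p + hP q.
Proof. by rewrite -[RHS]/(fprod_add _ _) fclassD; apply/fclassP/fc_PD. Qed.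
Lemma aff_polyM p q : hP (p * q) = hP p * hP q.
Proof. by rewrite -[RHS]/(fprod_mul _ _) fclassM; apply/fclassP/fc_PM. Qed.
Lemma aff_polyZ c p : hP (c *: p) = c *: hP p.
Proof. by rewrite -[RHS]/(fprod_scale _ _) fclassZ; apply/fclassP/fc_PZ. Qed.
Lemma aff_poly1 : hP 1 = 1.
Proof. by []. Qed.
Lemma aff_tensD p q : hT (p + q) = hT p + hT q.
Proof. by rewrite -[RHS]/(fprod_add _ _) fclassD; apply/fclassP/fc_TD. Qed.
Lemma aff_tensM p q : hT (p * q) = hT p * hT q.
Proof. by rewrite -[RHS]/(fprod_mul _ _) fclassM; apply/fclassP/fc_TM. Qed.
Lemma aff_tensZ c p : hT (c *: p) = c *: hT p.
Proof. by rewrite -[RHS]/(fprod_scale _ _) fclassZ; apply/fclassP/fc_TZ. Qed.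
Lemma aff_tens1 : hT 1 = 1.
Proof. by apply/fclassP/fc_T1. Qed.
Lemma aff_symD p q : hG (p + q) = hG p + hG q.
Proof. by rewrite -[RHS]/(fprod_add _ _) fclassD; apply/fclassP/fc_GD. Qed.
Lemma aff_symM p q : hG (p * q) = hG p * hG q.
Proof. by rewrite -[RHS]/(fprod_mul _ _) fclassM; apply/fclassP/fc_GM. Qed.
Lemma aff_symZ c p : hG (c *: p) = c *: hG p.
Proof. by rewrite -[RHS]/(fprod_scale _ _) fclassZ; apply/fclassP/fc_GZ. Qed.
Lemma aff_sym1 : hG 1 = 1.
Proof. by apply/fclassP/fc_G1. Qed.

Lemma aff_poly_lin : linear hP.
Proof. by move=> c p q; rewrite aff_polyD aff_polyZ. Qed.
HB.instance Definition _ := GRing.isLinear.Build k {mpoly k[n]} H *:%R hP aff_poly_lin.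
Lemma aff_tens_lin : linear hT.
Proof. by move=> c p q; rewrite aff_tensD aff_tensZ. Qed.
HB.instance Definition _ := GRing.isLinear.Build k B H *:%R hT aff_tens_lin.
Lemma aff_sym_lin : linear hG.
Proof. by move=> c p q; rewrite aff_symD aff_symZ. Qed.
HB.instance Definition _ := GRing.isLinear.Build k (symalg k n) H *:%R hG aff_sym_lin.

Lemma symeltM u v : symelt k u * symelt k v = symelt k (v * u)%g :> symalg k n.
Proof.
apply/ffunP => w; rewrite [LHS]skew_mulE (bigD1 u) //= big1 => [|x nx]; last first.
  by rewrite [symelt k u x]ffunE (negPf nx) mul0r.
rewrite addr0 !ffunE eqxx mul1r; congr (if _ then _ else _).
by rewrite (can2_eq (mulgKV u) (mulgK u)).
Qed.

Lemma symelt_sum (g : symalg k n) : g = \sum_w (g w : k) *: symelt k w.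
Proof.
apply/ffunP => w; rewrite sum_ffunE (bigD1 w) //= big1 => [|x nx].
  by rewrite !ffunE eqxx addr0 [RHS]mulr1.
by rewrite !ffunE eq_sym (negPf nx) scaler0.
Qed.

Lemma aff_symeltM u v : hW u * hW v = hW (v * u)%g.
Proof. by rewrite -aff_symM symeltM. Qed.
Lemma aff_symelt1 : hW 1%g = 1.
Proof. exact: aff_sym1. Qed.

Lemma aff_polytensC p a : hT a * hP p = hP p * hT a.
Proof.
elim/mpoly_gen_ind: p => [|i|c p q IHp IHq|p q IHp IHq].
- by rewrite aff_poly1 mulr1 mul1r.
- by rewrite -[LHS]/(fprod_mul _ _) -[RHS]/(fprod_mul _ _) !fclassM; apply/fclassP/fc_rel/aff_az.
- by rewrite linearP mulrDr mulrDl -aff_scaleAr -aff_scaleAl IHp IHq.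
- by rewrite aff_polyM mulrA IHp -mulrA IHq mulrA.
Qed.

Lemma aff_symtens w a : hW w * hT a = hT (tplace w a) * hW w.
Proof.
elim/perm_adjacent_ind: w a => [|i i' w ei IHw] a.
  by rewrite aff_symelt1 mul1r mulr1 tplace1.
rewrite -aff_symeltM -mulrA IHw mulrA.
have -> b : hW (tperm i i') * hT b = hT (tplace (tperm i i') b) * hW (tperm i i').
  rewrite -[LHS]/(fprod_mul _ _) -[RHS]/(fprod_mul _ _) !fclassM.
  by apply/fclassP/fc_rel/aff_sa.
by rewrite -mulrA tplace_comp.
Qed.

Lemma aff_symX (i i' j : 'I_n) : i' = i.+1 :> nat ->
  hW (tperm i i') * hP 'X_j = hP 'X_(tperm i i' j) * hW (tperm i i')
    + ((i == j)%:R - (i' == j)%:R : k) *: hT (Delta i i').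
Proof.
move=> ei; apply/eqP; rewrite addrC -subr_eq; apply/eqP.
rewrite -scaleN1r -aff_tensZ.
rewrite -[LHS]/(fprod_add (fprod_mul _ _) (fprod_scale (-1) (fprod_mul _ _))).
by rewrite !fclassM fclassZ fclassD; apply/fclassP/fc_rel/aff_sz.
Qed.

Lemma embed_lin : linear embed.
Proof.
move=> c x y; rewrite /aff_embed scaler_sumr -big_split; apply: eq_bigr => I _.
by rewrite !ffunE linearP mulrDl aff_scaleAl.
Qed.
HB.instance Definition _ := GRing.isLinear.Build k M H *:%R embed embed_lin.

Lemma embed_poly p x : embed (poly_mul p x) = hP p * embed x.
Proof.
rewrite /aff_embed mulr_sumr; apply: eq_bigr => I _.
by rewrite ffunE aff_polyM mulrA.
Qed.
Lemma embed_poly_r p x : embed (poly_mul p x) = embed x * hP p.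
Proof.
rewrite /aff_embed mulr_suml; apply: eq_bigr => I _.
by rewrite ffunE mulrC aff_polyM -!mulrA aff_polytensC.
Qed.
Lemma embed_lmul b x : embed (tens_lmul b x) = hT b * embed x.
Proof.
rewrite /aff_embed mulr_sumr.
under [RHS]eq_bigr => J _.
  rewrite mulrA aff_polytensC -mulrA -aff_tensM [b * _]tpow_sum linear_sum mulr_sumr.
  over.
rewrite exchange_big /=; apply: eq_bigr => I _.
rewrite ffunE linear_sum mulr_suml; apply: eq_bigr => J _.
by rewrite !linearZ /= -aff_scaleAl aff_scaleAr.
Qed.
Lemma embed_rmul b x : embed (tens_rmul b x) = embed x * hT b.
Proof.
rewrite /aff_embed mulr_suml.
under [RHS]eq_bigr => J _.
  rewrite -mulrA -aff_tensM [_ * b]tpow_sum linear_sum mulr_sumr.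
  over.
rewrite exchange_big /=; apply: eq_bigr => I _.
rewrite ffunE linear_sum mulr_suml; apply: eq_bigr => J _.
by rewrite !linearZ /= -aff_scaleAl aff_scaleAr.
Qed.
Lemma embed_one : embed (tens_one A n) = 1.
Proof.
transitivity (hT (\sum_I ((1 : B) I : k) *: e_ I)); last by rewrite -tpow_sum aff_tens1.
rewrite linear_sum; apply: eq_bigr => I _; rewrite linearZ /=.
have -> : tens_one A n I = ((1 : B) I : k) *: 1 by rewrite ffunE [(1 : B) I]pureE.
by rewrite linearZ /= aff_poly1 -aff_scaleAl mul1r.
Qed.

Definition normal_form (h : H) : Q := aff_act repZ repT repW h (single 1%g (tens_one A n)).

Definition of_normal_form (q : Q) : H := \sum_w hW w * embed (q w).

Lemma of_normal_form_lin : linear of_normal_form.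
Proof.
move=> c x y; rewrite /of_normal_form scaler_sumr -big_split; apply: eq_bigr => w _.
by rewrite !ffunE linearP mulrDr aff_scaleAr.
Qed.
HB.instance Definition _ := GRing.isLinear.Build k Q H *:%R of_normal_form of_normal_form_lin.

Lemma normal_form_lin : linear normal_form.
Proof.
by move=> c x y; rewrite /normal_form (aff_actDl rep_affine) (aff_actZl rep_affine).
Qed.

Lemma normal_form_sum (I : Type) (s : seq I) (F : I -> H) :
  normal_form (\sum_(i <- s) F i) = \sum_(i <- s) normal_form (F i).
Proof.
pose f := HB.pack_for {linear H -> Q} normal_form
  (GRing.isLinear.Build _ _ _ _ _ normal_form_lin).
exact: (linear_sum f).
Qed.

Lemma normal_form0 : normal_form 0 = 0.
Proof. by have := normal_form_lin (-1) 0 0; rewrite scaler0 addr0 scaleN1r addNr. Qed.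

Lemma of_normal_form_single w x : of_normal_form (single w x) = hW w * embed x.
Proof.
rewrite /of_normal_form (bigD1 w) //= ffunE eqxx big1 ?addr0 // => u nu.
by rewrite ffunE (negPf nu) linear0 mulr0.
Qed.

Lemma of_normal_formT a q : of_normal_form (repT a q) = hT a * of_normal_form q.
Proof.
rewrite /of_normal_form mulr_sumr; apply: eq_bigr => w _.
by rewrite ffunE embed_lmul !mulrA aff_symtens tplace_comp mulVg tplace1.
Qed.

Lemma of_normal_formW u q : of_normal_form (repW u q) = hW u * of_normal_form q.
Proof.
rewrite /of_normal_form mulr_sumr (reindex_inj (mulIg u)) /=; apply: eq_bigr => w _.
by rewrite ffunE mulgK mulrA aff_symeltM.
Qed.

Lemma of_normal_formZ j q : of_normal_form (repZ j q) = hP 'X_j * of_normal_form q.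
Proof.
rewrite [q]single_sum !linear_sum mulr_sumr; apply: eq_bigr => w _ /=.
move: (q w) => x {q}; elim/perm_adjacent_ind: w j => [|i i' w ei IHw] j.
  by rewrite repZ_single1 !of_normal_form_single aff_symelt1 !mul1r embed_poly.
rewrite -repW_single of_normal_formW -(tpermK i i' j).
move: (tperm i i' j) => {}j.
have /eqP := repWZ j (single w x) ei; rewrite -subr_eq => /eqP <-.
rewrite linearB /= of_normal_formW IHw linearZ /= of_normal_formT.
by rewrite mulrA aff_symX // mulrDl -aff_scaleAl -mulrA addrK.
Qed.

Lemma of_normal_form_act h q :
  of_normal_form (aff_act repZ repT repW h q) = h * of_normal_form q.
Proof.
have aa := rep_affine; have act := mpoly_act_action repZ_lin repZ_comm.
elim/fprod_ind: h q => [p|a|g|x y IHx IHy|x y IHx IHy|c x IHx] q.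
- rewrite (aff_act_poly aa) -/(hP p).
  elim/mpoly_gen_ind: p q => [|i|c f g IHf IHg|f g IHf IHg] q.
  + by rewrite (act1l act) aff_poly1 mul1r.
  + by rewrite mpoly_actXU of_normal_formZ.
  + rewrite (actDl act (c *: f) g q) (actZl act c f q).
    transitivity (c *: of_normal_form (mpoly_act repZ f q) + of_normal_form (mpoly_act repZ g q)).
      exact: of_normal_form_lin.
    by rewrite IHf IHg aff_poly_lin mulrDl -aff_scaleAl.
  + by rewrite (actMl act) IHf IHg aff_polyM mulrA.
- by rewrite (aff_act_tens aa) of_normal_formT.
- rewrite (aff_act_sym aa) -/(hG g).
  have -> : hG g = \sum_w (g w : k) *: hW w.
    by rewrite [in LHS](symelt_sum g) linear_sum; apply: eq_bigr => w _; rewrite linearZ.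
  rewrite mulr_suml /sym_act linear_sum.
  apply: eq_bigr => w _; rewrite linearZ /= of_normal_formW.
  by rewrite -aff_scaleAl.
- by rewrite (aff_actDl aa) linearD /= mulrDl IHx IHy.
- by rewrite (aff_actMl aa) IHx IHy mulrA.
- by rewrite (aff_actZl aa) linearZ /= IHx aff_scaleAl.
Qed.

Lemma normal_formK : cancel normal_form of_normal_form.
Proof.
move=> h; rewrite /normal_form of_normal_form_act of_normal_form_single.
by rewrite embed_one aff_symelt1 !mulr1.
Qed.

Lemma of_normal_formK : cancel of_normal_form normal_form.
Proof.
move=> q; have aa := rep_affine.
rewrite /of_normal_form normal_form_sum [RHS]single_sum; apply: eq_bigr => w _ /=.
rewrite /normal_form (aff_actMl aa) (aff_act_sym aa) sym_act_elt.
have -> : single w (q w) = repW w (single 1%g (q w)) by rewrite repW_single mul1g.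
congr (repW _ _).
pose f (h : H) := aff_act repZ repT repW h (single 1%g (tens_one A n)).
rewrite -[LHS]/(f (embed (q w))).
have -> : f (embed (q w)) = \sum_I f (hP (q w I) * hT (e_ I)).
  exact: normal_form_sum.
transitivity (single 1%g (\sum_I poly_mul (q w I) (tens_lmul (e_ I) (tens_one A n)))).
  rewrite linear_sum; apply: eq_bigr => I _ /=.
  rewrite /f (aff_actMl aa) (aff_act_poly aa) (aff_act_tens aa) -mpoly_act_single1.
  congr (mpoly_act _ _ _); apply/ffunP => u; rewrite !ffunE.
  by case: eqP => [->|_]; rewrite ?invg1 ?tplace1 ?linear0.
congr (single _ _); apply/ffunP => I; rewrite sum_ffunE (bigD1 I) //= tens_one_coord.
rewrite basis_coord eqxx scale1r big1 ?addr0 // => J nJ.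
by rewrite tens_one_coord basis_coord (negPf nJ) scale0r.
Qed.

Definition deg_le (D : nat) (x : M) := forall I, (msize (x I) <= D)%N.

Lemma deg_leW D E x : (D <= E)%N -> deg_le D x -> deg_le E x.
Proof. by move=> le h I; apply: leq_trans (h I) le. Qed.
Lemma deg_le_lin D c x y : deg_le D x -> deg_le D y -> deg_le D (c *: x + y).
Proof.
move=> hx hy I; rewrite !ffunE; apply: leq_trans (msizeD_le _ _) _.
by rewrite geq_max hy andbT (leq_trans (msizeZ_le _ _)).
Qed.
Lemma deg_le0 D : deg_le D 0.
Proof. by move=> I; rewrite ffunE msize0. Qed.
Lemma deg_leD D x y : deg_le D x -> deg_le D y -> deg_le D (x + y).
Proof. by move=> hx hy; rewrite -[x]scale1r; apply: deg_le_lin. Qed.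
Lemma deg_leZ D c x : deg_le D x -> deg_le D (c *: x).
Proof. by move=> hx; rewrite -[_ *: _]addr0; apply: deg_le_lin => //; apply: deg_le0. Qed.
Lemma deg_le_sum D (I : Type) (s : seq I) (F : I -> M) :
  (forall i, deg_le D (F i)) -> deg_le D (\sum_(i <- s) F i).
Proof.
by move=> h; apply: (big_ind (deg_le D)) => //; [apply: deg_le0|apply: deg_leD].
Qed.
Lemma deg_le_eq0 x : deg_le 0 x -> x = 0.
Proof.
by move=> h; apply/ffunP => I; rewrite ffunE; apply/eqP; rewrite -msize_poly_eq0 -leqn0.
Qed.
Lemma deg_le_lmul D b x : deg_le D x -> deg_le D (tens_lmul b x).
Proof.
move=> hx I; rewrite ffunE; apply: (leq_trans (msize_sum _ _ _)).
by apply/bigmax_leqP => J _; apply: leq_trans (msizeZ_le _ _) (hx J).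
Qed.
Definition filt (D : nat) (q : Q) := forall w, deg_le D (q w).

Lemma filtW D E q : (D <= E)%N -> filt D q -> filt E q.
Proof. by move=> le h w; apply: deg_leW (h w). Qed.
Lemma filt_lin D c x y : filt D x -> filt D y -> filt D (c *: x + y).
Proof. by move=> hx hy w; rewrite !ffunE; apply: deg_le_lin. Qed.
Lemma filt0 D : filt D 0.
Proof. by move=> w; rewrite ffunE; apply: deg_le0. Qed.
Lemma filtD D x y : filt D x -> filt D y -> filt D (x + y).
Proof. by move=> hx hy; rewrite -[x]scale1r; apply: filt_lin. Qed.
Lemma filtN D x : filt D x -> filt D (- x).
Proof. by move=> hx; rewrite -scaleN1r -[_ *: _]addr0; apply: filt_lin => //; apply: filt0. Qed.
Lemma filt_sum D (I : Type) (s : seq I) (F : I -> Q) :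
  (forall i, filt D (F i)) -> filt D (\sum_(i <- s) F i).
Proof. by move=> h; apply: (big_ind (filt D)) => //; [apply: filt0|apply: filtD]. Qed.
Lemma filt_eq0 q : filt 0 q -> q = 0.
Proof. by move=> h; apply/ffunP => w; rewrite ffunE; apply: deg_le_eq0. Qed.

Lemma filt_exists q : exists D, filt D q.
Proof.
exists (\max_(wI : 'S_n * tidx A n) msize (q wI.1 wI.2)) => w I.
exact: (leq_bigmax (w, I)).
Qed.

Definition lead_act (p : {mpoly k[n]}) (q : Q) : Q :=
  [ffun w => poly_mul (msym (inv w) p) (q w)].

Lemma lead_act_linl c p p' q : lead_act (c *: p + p') q = c *: lead_act p q + lead_act p' q.
Proof. by apply/ffunP => w; rewrite !ffunE linearP poly_mul_linl. Qed.
Lemma lead_actM p p' q : lead_act (p * p') q = lead_act p (lead_act p' q).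
Proof. by apply/ffunP => w; rewrite !ffunE msymM poly_mulM. Qed.

Lemma filt_lead D m q : filt D q -> filt (D + mdeg m) (lead_act 'X_[m] q).
Proof.
move=> hq w I; rewrite !ffunE msymX; apply: leq_trans (msizeXM_le _ _) _.
by rewrite mdeg_mperm leq_add2r; apply: hq.
Qed.

Lemma filt_repZ_lead D j q : filt D q -> filt D (repZ j q - lead_act 'X_j q).
Proof.
move=> hq w; rewrite !ffunE msymXU addrAC subrr add0r.
by apply: deg_le_sum => t; apply/deg_leZ/deg_le_lmul.
Qed.

Lemma filt_repZ D j q : filt D q -> filt D.+1 (repZ j q).
Proof.
move=> hq; rewrite -[repZ j q](subrK (lead_act 'X_j q)); apply: filtD.
  by apply: filtW (leqnSn D) _; apply: filt_repZ_lead.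
by rewrite -[D.+1]addn1 -(mdeg1 j); apply: filt_lead.
Qed.

Lemma filt_mnm_act D m q E : filt D q -> (D + mdeg m <= E.+1)%N ->
  filt E (mnm_act repZ m q - lead_act 'X_[m] q).
Proof.
move: {2}(mdeg m) (erefl (mdeg m)) => c; elim: c m E => [|c IHc] m E dm hq leE.
  move/eqP: dm; rewrite mdeg_eq0 => /eqP ->; rewrite mnm_act0 mpolyX0.
  have -> : lead_act 1 q = q by apply/ffunP => w; rewrite !ffunE msym1 poly_mul1.
  by rewrite subrr; apply: filt0.
have [i mi] : exists i, (0 < m i)%N.
  apply/existsP; apply: contra_eqT dm => /existsPn h.
  by rewrite mdegE big1 // => i _; apply/eqP; rewrite -leqn0 leqNgt.
pose m' := (m - U_(i))%MM.
have em : m = (U_(i) + m')%MM.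
  by rewrite addmC submK //; apply/mnm_lepP => l; rewrite mnm1E; case: eqP => // <-.
have dm' : mdeg m' = c by move: dm; rewrite em mdegD mdeg1 => -[].
rewrite em (mnm_actD repZ_comm) mnm_act1 mpolyXD lead_actM.
set u := mnm_act _ _ _; set v := lead_act _ q.
have -> : repZ i u - lead_act 'X_i v = repZ i (u - v) + (repZ i v - lead_act 'X_i v).
  by rewrite linearB addrA subrK.
have lE : (D + c <= E)%N by move: leE; rewrite em mdegD mdeg1 dm' addnS ltnS.
apply: filtD; last first.
  apply: filtW lE _; apply: filt_repZ_lead; rewrite -dm'; exact: filt_lead.
case: E {leE} lE => [|E] lE.
  have -> : u - v = 0 by apply: filt_eq0; apply: IHc; rewrite ?dm' // (leq_trans lE).
  by rewrite linear0; apply: filt0.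
by apply: filt_repZ; apply: IHc; rewrite ?dm'.
Qed.

Lemma filt_mpoly_act D p q : filt 1 q -> (msize p <= D.+1)%N ->
  filt D (mpoly_act repZ p q - lead_act p q).
Proof.
move=> hq lep; rewrite {2}[p]mpolyE.
have -> : lead_act (\sum_(m <- msupp p) p@_m *: 'X_[m]) q
    = \sum_(m <- msupp p) p@_m *: lead_act 'X_[m] q.
  elim: (msupp p) => [|m s IHs].
    by rewrite !big_nil; apply/ffunP => w; rewrite !ffunE linear0 -[0 in LHS](scale0r 0)
      -[0 *: 0]addr0 poly_mul_linl !scale0r add0r; apply/ffunP => I; rewrite !ffunE mul0r.
  by rewrite !big_cons lead_act_linl IHs.
rewrite -sumrB big_seq_cond; apply: (big_ind (filt D)); [exact: filt0|exact: filtD|].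
move=> m; rewrite andbT => pm; rewrite -scalerBr -[_ *: _]addr0.
apply: filt_lin; last exact: filt0.
apply: filt_mnm_act (hq) _; rewrite add1n ltnS.
by rewrite -ltnS; apply: leq_trans lep; apply: msize_mdeg_lt.
Qed.

Definition of_left_form (q : Q) : H := \sum_w embed (q w) * hW w.

Lemma of_left_form_lin : linear of_left_form.
Proof.
move=> c x y; rewrite /of_left_form scaler_sumr -big_split; apply: eq_bigr => w _.
by rewrite !ffunE linearP mulrDl aff_scaleAl.
Qed.
HB.instance Definition _ := GRing.isLinear.Build k Q H *:%R of_left_form of_left_form_lin.

Lemma of_left_form_single w x : of_left_form (single w x) = embed x * hW w.
Proof.
rewrite /of_left_form (bigD1 w) //= ffunE eqxx big1 ?addr0 // => u nu.
by rewrite ffunE (negPf nu) linear0 mul0r.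
Qed.

Definition twist (q : Q) : Q := [ffun w => diag_act (inv w) (q w)].
Definition untwist (q : Q) : Q := [ffun w => diag_act w (q w)].

Lemma diag_act_comp u v (x : M) : diag_act u (diag_act v x) = diag_act (v * u)%g x.
Proof.
apply/ffunP => I; rewrite !ffunE -msymMm; congr (msym _ (x _)).
by apply/ffunP => t; rewrite !ffunE permM.
Qed.
Lemma diag_act1 (x : M) : diag_act 1%g x = x.
Proof. by apply/ffunP => I; rewrite !ffunE msym1m; congr (x _); apply/ffunP => t; rewrite ffunE perm1. Qed.

Lemma untwistK q : twist (untwist q) = q.
Proof. by apply/ffunP => w; rewrite !ffunE diag_act_comp mulgV diag_act1. Qed.
Lemma twistK q : untwist (twist q) = q.
Proof. by apply/ffunP => w; rewrite !ffunE diag_act_comp mulVg diag_act1. Qed.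
Lemma deg_le_diag D w x : deg_le D x -> deg_le D (diag_act w x).
Proof. by move=> hx I; rewrite ffunE; apply: leq_trans (msize_msym _ _) _; rewrite ffunE. Qed.

Lemma normal_left_form D q : filt D.+1 q ->
  filt D (normal_form (of_left_form q) - twist q).
Proof.
move=> hq; have aa := rep_affine.
pose v w I := repT (e_ I) (single w (tens_one A n)).
have -> : normal_form (of_left_form q) = \sum_w \sum_I mpoly_act repZ (q w I) (v w I).
  rewrite normal_form_sum.
  apply: eq_bigr => w _; rewrite /aff_embed mulr_suml normal_form_sum; apply: eq_bigr => I _ /=.
  rewrite /normal_form !(aff_actMl aa) (aff_act_poly aa) (aff_act_tens aa) (aff_act_sym aa).
  by rewrite sym_act_elt repW_single mul1g.
have -> : twist q = \sum_w \sum_I lead_act (q w I) (v w I).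
  apply/ffunP => w; rewrite sum_ffunE (bigD1 w) //=.
  rewrite [X in _ = _ + X]big1 ?addr0 => [|u nu]; last first.
    rewrite sum_ffunE big1 // => I _; rewrite !ffunE eq_sym (negPf nu) linear0.
    by rewrite linear0.
  apply/ffunP => J; pose J' : tidx A n := [ffun t => J ((inv w) t)].
  rewrite !sum_ffunE [LHS](_ : _ = msym (inv w) (q w J')); last by rewrite !ffunE.
  have E I : lead_act (q w I) (v w I) w J = ((e_ I J' : k) *: msym (inv w) (q w I)).
    rewrite ffunE [v w I w]ffunE [single _ _ _]ffunE eqxx tens_one_coord; congr (_ *: _).
    by rewrite ffunE.
  rewrite (bigD1 J') //= E basis_coord eqxx scale1r big1 ?addr0 // => I nI.
  by rewrite E basis_coord (negPf nI) scale0r.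
rewrite -sumrB; apply: filt_sum => w; rewrite -sumrB; apply: filt_sum => I.
apply: filt_mpoly_act; last exact: hq.
move=> u; rewrite !ffunE; apply: deg_le_lmul.
case: eqP => _; last exact: deg_le0.
move=> J; rewrite ffunE; apply: leq_trans (msizeZ_le _ _) _.
by rewrite msize1.
Qed.

Lemma filt_untwist D q : filt D q -> filt D (untwist q).
Proof. by move=> hq w; rewrite ffunE; apply: deg_le_diag. Qed.
Lemma untwistN q : untwist (- q) = - untwist q.
Proof. by apply/ffunP => w; apply/ffunP => I; rewrite !ffunE linearN. Qed.
Lemma of_left_form_inj : injective of_left_form.
Proof.
apply: raddf_inj => q q0; have [D] := filt_exists q.
elim: D => [|D IHD] hq; first exact: filt_eq0.
apply: IHD; rewrite -[q]twistK -[twist q]opprK untwistN; apply/filtN/filt_untwist.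
rewrite -[- _]add0r.
suff -> : 0 = normal_form (of_left_form q) :> Q by apply: normal_left_form.
by rewrite q0 (normal_form0).
Qed.

Lemma of_left_form_surj h : exists q, h = of_left_form q.
Proof.
suff [q e] : exists q, normal_form (of_left_form q) = normal_form h.
  by exists q; rewrite -[h]normal_formK -e normal_formK.
have nfD x y : normal_form (x - y) = normal_form x - normal_form y.
  by rewrite -!scaleN1r ![_ + -1 *: _]addrC normal_form_lin.
move: (normal_form h) => y; have [D] := filt_exists y.
elim: D y => [|D IHD] y hy.
  exists 0; rewrite (filt_eq0 hy) linear0.
  exact: normal_form0.
have [q1 e1] := IHD _ (normal_left_form (filt_untwist hy)).
exists (untwist y - q1); rewrite linearB nfD /= e1 untwistK.
by rewrite opprB addrC subrK.
Qed.

Definition mono_tens (p : {mpoly k[n]}) (a : B) : M := [ffun J => (a J : k) *: p].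

Lemma embed_mono_tens p a : embed (mono_tens p a) = hP p * hT a.
Proof.
rewrite [a in RHS]tpow_sum linear_sum mulr_sumr; apply: eq_bigr => J _.
by rewrite ffunE !linearZ /= -aff_scaleAl aff_scaleAr.
Qed.

Lemma mono_tens_basis p J : mono_tens p (e_ J) = [ffun K => if K == J then p else 0].
Proof.
apply/ffunP => K; rewrite [LHS]ffunE [RHS]ffunE basis_coord eq_sym.
by case: eqP => _; rewrite ?scale1r ?scale0r.
Qed.

Lemma embed_basis p J : embed [ffun K => if K == J then p else 0] = hP p * hT (e_ J).
Proof. by rewrite -mono_tens_basis embed_mono_tens. Qed.

Definition poly_gen (i : 'S_n * tidx A n) (p : {mpoly k[n]}) : Q :=
  single i.1 [ffun K => if K == i.2 then p else 0].
Definition poly_coord (i : 'S_n * tidx A n) (q : Q) : {mpoly k[n]} := q i.1 i.2.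

Definition tens_gen (i : 'S_n * 'X_{1..n}) (a : B) : Q := single i.1 (mono_tens 'X_[i.2] a).
Definition tens_coord (i : 'S_n * 'X_{1..n}) (q : Q) : B := [ffun J => (q i.1 J)@_i.2].

Definition sym_gen (i : tidx A n * 'X_{1..n}) (g : symalg k n) : Q :=
  [ffun w => [ffun K => if K == i.1 then (g w : k) *: 'X_[i.2] else 0]].
Definition sym_coord (i : tidx A n * 'X_{1..n}) (q : Q) : symalg k n :=
  [ffun w => (q w i.1)@_i.2].

Lemma poly_coord_additive i : additive (poly_coord i).
Proof. by move=> x y; rewrite /poly_coord !ffunE. Qed.
HB.instance Definition _ i :=
  GRing.isAdditive.Build Q {mpoly k[n]} (poly_coord i) (poly_coord_additive i).
Lemma tens_coord_additive i : additive (tens_coord i).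
Proof. by move=> x y; apply/ffunP => J; rewrite !ffunE mcoeffB. Qed.
HB.instance Definition _ i :=
  GRing.isAdditive.Build Q B (tens_coord i) (tens_coord_additive i).
Lemma sym_coord_additive i : additive (sym_coord i).
Proof. by move=> x y; apply/ffunP => w; rewrite !ffunE mcoeffB. Qed.
HB.instance Definition _ i :=
  GRing.isAdditive.Build Q (symalg k n) (sym_coord i) (sym_coord_additive i).

Lemma poly_coordE i j c : poly_coord i (poly_gen j c) = if i == j then c else 0.
Proof.
case: i j => [w I] [v J]; rewrite /poly_coord /poly_gen xpair_eqE ffunE /=.
by have [_|_] := eqVneq w v; rewrite ffunE.
Qed.
Lemma tens_coordE i j c : tens_coord i (tens_gen j c) = if i == j then c else 0.
Proof.
case: i j => [w m] [v m']; apply/ffunP => K; rewrite /tens_gen xpair_eqE ffunE ffunE /=.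
have [_|_] := eqVneq w v; last by rewrite !ffunE mcoeff0.
rewrite ffunE mcoeffZ mcoeffX eq_sym; have [_|_] := eqVneq m m'; first by rewrite mulr1.
by rewrite mulr0 ffunE.
Qed.
Lemma sym_coordE i j c : sym_coord i (sym_gen j c) = if i == j then c else 0.
Proof.
case: i j => [I m] [J m']; apply/ffunP => w; rewrite /sym_gen xpair_eqE ffunE ffunE ffunE /=.
have [_|_] := eqVneq I J; last by rewrite ffunE mcoeff0.
rewrite mcoeffZ mcoeffX eq_sym; have [_|_] := eqVneq m m'; first by rewrite mulr1.
by rewrite mulr0 ffunE.
Qed.

Lemma poly_span (q : Q) : exists s, q = \sum_(i <- s) poly_gen i (poly_coord i q).
Proof.
exists (enum {: 'S_n * tidx A n}); rewrite big_enum /=.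
apply/ffunP => w; apply/ffunP => I; rewrite !sum_ffunE (bigD1 (w, I)) //=.
have E i : poly_gen i (poly_coord i q) w I = if (w, I) == i then q w I else 0.
  have := poly_coordE (w, I) i (poly_coord i q); rewrite /poly_coord /= => ->.
  by case: eqP => // <-.
by rewrite E eqxx big1 ?addr0 // => i ni; rewrite E eq_sym (negPf ni).
Qed.

Lemma tens_span (q : Q) : exists s, q = \sum_(i <- s) tens_gen i (tens_coord i q).
Proof.
have [D hq] := filt_exists q.
exists [seq (x.1, val x.2) | x <- enum {: 'S_n * 'X_{1..n < D}}].
rewrite big_map big_enum /=; apply/ffunP => w; apply/ffunP => I.
rewrite sum_ffunE sum_ffunE [q w I](mpolywE (hq w I)).
rewrite -(pair_bigA _ (fun v m => tens_gen (v, val m) (tens_coord (v, val m) q) w I)) /=.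
rewrite (bigD1 w) //= [X in _ = _ + X]big1 ?addr0 => [|v nv]; last first.
  by rewrite big1 // => m _; rewrite /tens_gen ffunE eq_sym (negPf nv) ffunE.
by apply: eq_bigr => m _; rewrite /tens_gen ffunE eqxx !ffunE.
Qed.

Lemma sym_span (q : Q) : exists s, q = \sum_(i <- s) sym_gen i (sym_coord i q).
Proof.
have [D hq] := filt_exists q.
exists [seq (x.1, val x.2) | x <- enum {: tidx A n * 'X_{1..n < D}}].
rewrite big_map big_enum /=; apply/ffunP => w; apply/ffunP => I.
rewrite sum_ffunE sum_ffunE [q w I](mpolywE (hq w I)).
rewrite -(pair_bigA _ (fun J m => sym_gen (J, val m) (sym_coord (J, val m) q) w I)) /=.
rewrite (bigD1 I) //= [X in _ = _ + X]big1 ?addr0 => [|J nJ]; last first.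
  by rewrite big1 // => m _; rewrite /sym_gen !ffunE eq_sym (negPf nJ).
by apply: eq_bigr => m _; rewrite /sym_gen !ffunE eqxx.
Qed.

Lemma of_normal_form_inj : injective of_normal_form.
Proof. exact: can_inj of_normal_formK. Qed.
Lemma of_normal_form_surj h : exists q, h = of_normal_form q.
Proof. by exists (normal_form h); rewrite normal_formK. Qed.

Lemma aff_sym_sum (g : symalg k n) : hG g = \sum_w (g w : k) *: hW w.
Proof.
by rewrite [in LHS](symelt_sum g) linear_sum; apply: eq_bigr => w _; rewrite linearZ.
Qed.

Lemma free_left_poly : free_left hP.
Proof.
apply: (free_left_of_coord (psi := of_left_form) (coord := poly_coord)
  (b := fun i => hT (e_ i.2) * hW i.1) (g := poly_gen)).
- exact: of_left_form_inj.
- exact: of_left_form_surj.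
- by move=> i c; rewrite /= of_left_form_single embed_basis mulrA.
- exact: poly_coordE.
- exact: poly_span.
Qed.

Lemma free_right_poly : free_right hP.
Proof.
apply: (free_right_of_coord (psi := of_normal_form) (coord := poly_coord)
  (b := fun i => hW i.1 * hT (e_ i.2)) (g := poly_gen)).
- exact: of_normal_form_inj.
- exact: of_normal_form_surj.
- by move=> i c; rewrite /= of_normal_form_single embed_basis -aff_polytensC mulrA.
- exact: poly_coordE.
- exact: poly_span.
Qed.

Lemma free_left_tens : free_left hT.
Proof.
apply: (free_left_of_coord (psi := of_left_form) (coord := tens_coord)
  (b := fun i => hP 'X_[i.2] * hW i.1) (g := tens_gen)).
- exact: of_left_form_inj.
- exact: of_left_form_surj.
- by move=> i c; rewrite /= of_left_form_single embed_mono_tens -aff_polytensC mulrA.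
- exact: tens_coordE.
- exact: tens_span.
Qed.

Lemma free_right_tens : free_right hT.
Proof.
apply: (free_right_of_coord (psi := of_normal_form) (coord := tens_coord)
  (b := fun i => hW i.1 * hP 'X_[i.2]) (g := tens_gen)).
- exact: of_normal_form_inj.
- exact: of_normal_form_surj.
- by move=> i c; rewrite /= of_normal_form_single embed_mono_tens mulrA.
- exact: tens_coordE.
- exact: tens_span.
Qed.

Lemma free_left_sym : free_left hG.
Proof.
apply: (free_left_of_coord (psi := of_normal_form) (coord := sym_coord)
  (b := fun i => hP 'X_[i.2] * hT (e_ i.1)) (g := sym_gen)).
- exact: of_normal_form_inj.
- exact: of_normal_form_surj.
- move=> i c; rewrite aff_sym_sum mulr_suml; apply: eq_bigr => w _.
  by rewrite ffunE embed_basis linearZ /= -!aff_scaleAl -aff_scaleAr.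
- exact: sym_coordE.
- exact: sym_span.
Qed.

Lemma free_right_sym : free_right hG.
Proof.
apply: (free_right_of_coord (psi := of_left_form) (coord := sym_coord)
  (b := fun i => hP 'X_[i.2] * hT (e_ i.1)) (g := sym_gen)).
- exact: of_left_form_inj.
- exact: of_left_form_surj.
- move=> i c; rewrite aff_sym_sum mulr_sumr; apply: eq_bigr => w _.
  by rewrite ffunE embed_basis linearZ /= -!aff_scaleAl -aff_scaleAr.
- exact: sym_coordE.
- exact: sym_span.
Qed.

(** * The center *)

Lemma embed_single1 x : embed x = of_normal_form (single 1%g x).
Proof. by rewrite of_normal_form_single aff_symelt1 mul1r. Qed.

Lemma embed_inj : injective embed.
Proof.
move=> x y; rewrite !embed_single1 => /(can_inj of_normal_formK).
by move/ffunP/(_ 1%g); rewrite !ffunE eqxx.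
Qed.

Lemma of_normal_form_poly_r q p :
  of_normal_form q * hP p = of_normal_form [ffun w => poly_mul p (q w)].
Proof.
by rewrite mulr_suml; apply: eq_bigr => w _; rewrite ffunE embed_poly_r mulrA.
Qed.

Lemma deg_le_XB (i j : 'I_n) (x : M) D : i != j -> deg_le D (poly_mul ('X_i - 'X_j) x) -> deg_le D.-1 x.
Proof. by move=> nij h I; apply: msize_XB nij _; have := h I; rewrite ffunE. Qed.

Lemma poly_mul_XB_eq0 (i j : 'I_n) (x : M) : i != j -> poly_mul ('X_i - 'X_j) x = 0 -> x = 0.
Proof.
move=> nij e; apply: deg_le_eq0; apply: (@deg_le_XB i j x 0%N) => //.
by rewrite e; apply: deg_le0.
Qed.

Lemma poly_mulBl f g (x : M) : poly_mul (f - g) x = poly_mul f x - poly_mul g x.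
Proof. by apply/ffunP => I; rewrite !ffunE mulrBl. Qed.

(* The embed (q 1) part of h commutes with z_i and is removed first. In top degree,
   the rest satisfies (z_i - z_{w^-1 i}) q(w) = 0. *)
Lemma poly_centralizer h : (forall i, hP 'X_i * h = h * hP 'X_i) -> exists x, h = embed x.
Proof.
move=> hc; have [q eh] := of_normal_form_surj h.
exists (q 1%g); rewrite embed_single1 eh; congr of_normal_form.
have qZ i : repZ i q = [ffun w => poly_mul 'X_i (q w)].
  apply: (can_inj of_normal_formK).
  by rewrite of_normal_formZ -eh hc eh of_normal_form_poly_r.
pose q' := q - single 1%g (q 1%g).
suff : q' = 0 by move/eqP; rewrite subr_eq0 => /eqP.
have q'1 : q' 1%g = 0 by rewrite !ffunE eqxx subrr.
have q'Z i : repZ i q' = [ffun w => poly_mul 'X_i (q' w)].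
  rewrite linearB /= qZ repZ_single1; apply/ffunP => w; rewrite !ffunE linearB.
  by congr (_ - _); case: eqP => _; rewrite // linear0.
move: q' q'1 q'Z => {qZ eh} {}q q1 qZ.
have [D] := filt_exists q; elim: D => [|D IHD] hq; first exact: filt_eq0.
apply: IHD => w.
have [->|nw] := eqVneq w 1%g; first by rewrite q1; apply: deg_le0.
have [i ni] : exists i, i != (inv w) i.
  apply/existsP; apply: contraNT nw => /existsPn hw; apply/eqP/permP => i.
  by have := hw (w i); rewrite negbK permK perm1 => /eqP.
have := filt_repZ_lead i hq w.
rewrite qZ !ffunE msymXU -poly_mulBl; exact: deg_le_XB.
Qed.

Lemma lmul_mono_tens b p a : tens_lmul b (mono_tens p a) = mono_tens p (b * a).
Proof.
apply/ffunP => I; rewrite !ffunE [a in RHS]tpow_sum mulr_sumr sum_ffunE scaler_suml.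
by apply: eq_bigr => J _; rewrite ffunE -scalerAr ffunE !scalerA mulrC.
Qed.
Lemma rmul_mono_tens b p a : tens_rmul b (mono_tens p a) = mono_tens p (a * b).
Proof.
apply/ffunP => I; rewrite !ffunE [a in RHS]tpow_sum mulr_suml sum_ffunE scaler_suml.
by apply: eq_bigr => J _; rewrite ffunE -scalerAl ffunE !scalerA mulrC.
Qed.
Lemma poly_mul_mono_tens f p a : poly_mul f (mono_tens p a) = mono_tens (f * p) a.
Proof. by apply/ffunP => I; rewrite !ffunE scalerAr. Qed.

Lemma mono_tens_sum (x : M) : x = \sum_I mono_tens (x I) (e_ I).
Proof.
apply/ffunP => J; rewrite sum_ffunE (bigD1 J) //= ffunE basis_coord eqxx scale1r.
by rewrite big1 ?addr0 // => I nI; rewrite ffunE basis_coord (negPf nI) scale0r.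
Qed.

Lemma diag_act_mono_tens w p a : diag_act w (mono_tens p a) = mono_tens (msym w p) (tplace w a).
Proof. by apply/ffunP => I; rewrite !ffunE linearZ. Qed.

Lemma diag_act_lin w : linear (@diag_act k A n w).
Proof. by move=> c x y; apply/ffunP => I; rewrite !ffunE linearP. Qed.
HB.instance Definition _ w := GRing.isLinear.Build k M M *:%R (@diag_act k A n w) (diag_act_lin w).

Lemma sym_poly (i i' : 'I_n) (f : {mpoly k[n]}) : i' = i.+1 :> nat ->
  exists g, hW (tperm i i') * hP f
      = hP (msym (tperm i i') f) * hW (tperm i i') + hP g * hT (Delta i i')
    /\ ('X_i - 'X_i') * g = f - msym (tperm i i') f.
Proof.
move=> ei; have nii : i != i' by rewrite -val_eqE /= ei ltn_eqF.
elim/mpoly_gen_ind: f => [|j|c p q [g [eg dg]] [h [eh dh]]|p q [g [eg dg]] [h [eh dh]]].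
- exists 0; rewrite msym1 aff_poly1 mulr1 mul1r linear0 mul0r addr0.
  by rewrite mulr0 subrr.
- exists (((i == j)%:R - (i' == j)%:R : k) *: 1); rewrite msymXU aff_symX //.
  split; first by rewrite linearZ /= aff_poly1 -aff_scaleAl mul1r.
  rewrite -scalerAr mulr1; case: tpermP => [->|->|/eqP n1 /eqP n2].
  + by rewrite eqxx eq_sym (negPf nii) subr0 scale1r.
  + by rewrite eqxx (negPf nii) sub0r scaleN1r opprB.
  + by rewrite eq_sym (negPf n1) eq_sym (negPf n2) !subrr scale0r.
- exists (c *: g + h); split; last first.
    by rewrite linearP mulrDr -scalerAr dg dh scalerBr opprD addrACA.
  rewrite !linearP /= mulrDr !mulrDl -!aff_scaleAr -!aff_scaleAl eg eh.
  by rewrite scalerDr addrACA.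
- exists (msym (tperm i i') p * h + g * q); split.
    rewrite msymM !aff_polyM mulrA eg mulrDl -!mulrA eh mulrDr !mulrA linearD /= mulrDl.
    by rewrite !aff_polyM -addrA -!mulrA aff_polytensC.
  rewrite mulrDr mulrCA dh mulrA dg msymM mulrBr mulrBl.
  by rewrite addrC addrA subrK.
Qed.

Lemma sym_embed (i i' : 'I_n) (x : M) : i' = i.+1 :> nat ->
  exists y, hW (tperm i i') * embed x = embed (diag_act (tperm i i') x) * hW (tperm i i') + embed y
    /\ poly_mul ('X_i - 'X_i') y
         = tens_lmul (Delta i i') x - tens_rmul (Delta i i') (diag_act (tperm i i') x).
Proof.
move=> ei; have nii : i != i' by rewrite -val_eqE /= ei ltn_eqF.
have [g gP] := fin_all_exists (fun I : tidx A n => sym_poly (x I) ei).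
set s := tperm i i'.
have dx : diag_act s x = \sum_I mono_tens (msym s (x I)) (tplace s (e_ I)).
  rewrite {1}[x]mono_tens_sum linear_sum; apply: eq_bigr => I _.
  exact: diag_act_mono_tens.
exists (\sum_I mono_tens (g I) (Delta i i' * e_ I)); split.
  rewrite dx !linear_sum mulr_suml mulr_sumr -big_split; apply: eq_bigr => I _ /=.
  rewrite !embed_mono_tens mulrA (gP I).1 mulrDl -!mulrA aff_symtens.
  by rewrite -aff_tensM.
rewrite dx {1}[x]mono_tens_sum !linear_sum -big_split; apply: eq_bigr => I _ /=.
rewrite poly_mul_mono_tens (gP I).2 lmul_mono_tens rmul_mono_tens -(Delta_comm sym) //.
by apply/ffunP => J; rewrite !ffunE scalerBr.
Qed.

Lemma central_commutes h : is_central h <->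
  exists x : M, [/\ forall a : B, tens_lmul a x = tens_rmul a x, diag_invariant x & h = embed x].
Proof.
split=> [hc|[x [xT xW ->]]].
  have [x ex] := poly_centralizer (fun i => esym (hc (hP 'X_i))).
  exists x; split=> //.
    by move=> a; apply: embed_inj; rewrite embed_lmul embed_rmul -ex hc.
  elim/perm_adjacent_ind => [|i i' w ei IHw]; first by rewrite diag_act1.
  rewrite -diag_act_comp IHw; have [y [ey _]] := sym_embed x ei.
  have nii : i != i' by rewrite -val_eqE /= ei ltn_eqF.
  have ns : tperm i i' != 1%g by apply: contra_neq nii => /permP/(_ i'); rewrite tpermR perm1.
  have : of_left_form (single (tperm i i') (x - diag_act (tperm i i') x)) =
         of_left_form (single 1%g y) :> H.
    rewrite !of_left_form_single aff_symelt1 mulr1 linearB mulrBl /= -[embed x]ex hc ex ey.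
    by rewrite addrAC subrr add0r.
  move/of_left_form_inj/ffunP/(_ (tperm i i')); rewrite !ffunE eqxx (negPf ns).
  by move/eqP; rewrite subr_eq0 => /eqP.
have xS w : hW w * embed x = embed x * hW w.
  elim/perm_adjacent_ind: w => [|i i' w ei IHw]; first by rewrite aff_symelt1 mul1r mulr1.
  rewrite -aff_symeltM -mulrA IHw !mulrA; congr (_ * _).
  have [y [-> dy]] := sym_embed x ei; rewrite xW.
  have nii : i != i' by rewrite -val_eqE /= ei ltn_eqF.
  have -> : y = 0 by apply: (poly_mul_XB_eq0 nii); rewrite dy xW xT subrr.
  by rewrite linear0 addr0.
elim/fprod_ind => [p|a|g|y z IHy IHz|y z IHy IHz|c y IHy].
- by rewrite -[fprod_inP _ _]/(hP p) -embed_poly_r embed_poly.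
- by rewrite -[fprod_inT _ _]/(hT a) -embed_rmul -xT embed_lmul.
- rewrite -[fprod_inG _ _]/(hG g) aff_sym_sum mulr_sumr mulr_suml.
  by apply: eq_bigr => w _; rewrite -aff_scaleAr -aff_scaleAl xS.
- by rewrite mulrDr mulrDl IHy IHz.
- by rewrite mulrA IHy -mulrA IHz mulrA.
- by rewrite -aff_scaleAr -aff_scaleAl IHy.
Qed.

End RegularRepresentation.

(** * Slotwise centers *)

Section SlotCenters.
Variables (k : comNzRingType) (A : freeAlgType k) (n : nat).
Local Notation B := (tpow A n).
Local Notation M := (polytens A n).
Local Notation e_ I := (pure (tbasis (A := A) I) : B).
Local Notation idx := (tidx A n).
Local Notation mono_tens := (@mono_tens k A n).

Lemma mtens_mono_tens (f : {mpoly k[n]}) (a : 'I_n -> A) : mtens f a = mono_tens f (pure a).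
Proof. by apply/ffunP => I; rewrite [LHS]ffunE [RHS]ffunE pureE. Qed.

Lemma central_slots0 (S : {set 'I_n}) : central_slots S (0 : M).
Proof.
exists 0%N, (fun=> 0), (fun=> fun=> 1); split; first by case.
by rewrite big_ord0.
Qed.

Lemma central_slotsD (S : {set 'I_n}) (x y : M) :
  central_slots S x -> central_slots S y -> central_slots S (x + y).
Proof.
move=> [m [f [a [ca ->]]]] [m' [f' [a' [ca' ->]]]].
exists (m + m')%N, (fun i => match split i with inl j => f j | inr j => f' j end),
  (fun i => match split i with inl j => a j | inr j => a' j end); split.
  by move=> i t tS; case: split => j; [apply: ca|apply: ca'].
rewrite big_split_ord /=; congr (_ + _); apply: eq_bigr => i _.
  by rewrite (unsplitK (inl i)).
by rewrite (unsplitK (inr i)).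
Qed.

Lemma central_slots_sum (S : {set 'I_n}) (I : Type) (s : seq I) (P : pred I) (F : I -> M) :
  (forall i, P i -> central_slots S (F i)) -> central_slots S (\sum_(i <- s | P i) F i).
Proof.
by apply: big_ind; [apply: central_slots0|move=> x y; apply: central_slotsD].
Qed.

Lemma central_slots_mtens (S : {set 'I_n}) f (a : 'I_n -> A) :
  (forall t, t \in S -> is_central (a t)) -> central_slots S (mtens f a : M).
Proof.
by move=> ca; exists 1%N, (fun=> f), (fun=> a); rewrite big_ord1; split=> // _; apply: ca.
Qed.

Lemma central_slotsW (S S' : {set 'I_n}) (x : M) : S' \subset S ->
  central_slots S x -> central_slots S' x.
Proof.
move=> /subsetP sS [m [f [a [ca ->]]]]; exists m, f, a; split=> // i t /sS; exact: ca.
Qed.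

Definition slot_unit (t : 'I_n) (b : A) : B := pure (slot t b (fun=> 1)).

Lemma central_slot_commutes t (x : M) b : central_slots [set t] x ->
  tens_lmul (slot_unit t b) x = tens_rmul (slot_unit t b) x.
Proof.
move=> [m [f [a [ca ->]]]]; rewrite !linear_sum; apply: eq_bigr => i _ /=.
rewrite mtens_mono_tens lmul_mono_tens rmul_mono_tens; congr (mono_tens _ _).
rewrite [LHS]tmul_pure [RHS]tmul_pure; apply: eq_pure => v; rewrite /slot.
by case: eqP => [->|_]; [rewrite ca ?set11|rewrite mulr1 mul1r].
Qed.

Lemma commutes_of_slots (x : M) :
  (forall t b, tens_lmul (slot_unit t b) x = tens_rmul (slot_unit t b) x) ->
  forall a : B, tens_lmul a x = tens_rmul a x.
Proof.
move=> hx a; rewrite (tpow_sum a).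
have sumE (f : B -> M -> M) (F : idx -> B) :
    (forall c a b y, f (c *: a + b) y = c *: f a y + f b y) ->
    f (\sum_I a I *: F I) x = \sum_I a I *: f (F I) x.
  move=> lf; have f0 : f 0 x = 0.
    by have := lf (-1) 0 0 x; rewrite scaler0 addr0 scaleN1r addNr.
  elim/big_rec2: _ => // I y z _ <-; exact: lf.
rewrite (sumE (@tens_lmul k A n _)); last exact: tens_lmul_linl.
rewrite (sumE (@tens_rmul k A n _)); last exact: tens_rmul_linl.
apply: eq_bigr => I _; congr (_ *: _); move: (tbasis I) => b {sumE}.
suff h c : (c <= n)%N -> tens_lmul (pure (fun s : 'I_n => if (s < c)%N then b s else 1)) x =
    tens_rmul (pure (fun s : 'I_n => if (s < c)%N then b s else 1)) x.
  by have := h n (leqnn n); rewrite (@eq_pure _ _ _ _ b) // => s; rewrite ltn_ord.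
elim: c => [|c IHc] lec.
  by rewrite -[pure _]/(1 : B) tens_lmul1 tens_rmul1.
pose t := Ordinal lec.
have -> : pure (fun s : 'I_n => if (s < c.+1)%N then b s else 1) =
    pure (fun s : 'I_n => if (s < c)%N then b s else 1) * slot_unit t (b t) :> B.
  rewrite [RHS]tmul_pure; apply: eq_pure => s; rewrite /slot ltnS leq_eqVlt -val_eqE /=.
  by case: ltngtP => [_|_|e] /=; rewrite ?mulr1 ?mul1r //; congr b; apply: val_inj.
by rewrite tens_lmulM tens_rmulM hx tens_lrmul IHc // ltnW.
Qed.

Definition upd (t : 'I_n) (i : 'I_(dim A)) (I : idx) : idx :=
  [ffun s => if s == t then i else I s].

Lemma upd_upd t i j I : upd t i (upd t j I) = upd t i I.
Proof. by apply/ffunP => s; rewrite !ffunE; case: eqP. Qed.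
Lemma updC t u i j I : t != u -> upd t i (upd u j I) = upd u j (upd t i I).
Proof.
by move=> ntu; apply/ffunP => s; rewrite !ffunE; case: eqP => // ->; rewrite (negPf ntu).
Qed.
Lemma upd_same t (I : idx) : upd t (I t) I = I.
Proof. by apply/ffunP => s; rewrite !ffunE; case: eqP => // ->. Qed.
Lemma upd_at t i (I : idx) : upd t i I t = i.
Proof. by rewrite ffunE eqxx. Qed.

Lemma sum_off_slot t (I : idx) (F : idx -> k) :
  \sum_(J : idx) F J * \prod_(v | v != t) fcoord (I v) (fbasis (J v) : A) = \sum_i F (upd t i I).
Proof.
transitivity (\sum_(J : idx | J == upd t (J t) I) F J).
  rewrite [RHS]big_mkcond; apply: eq_bigr => J _.
  have [e|ne] := eqVneq J (upd t (J t) I).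
    rewrite big1 ?mulr1 // => v nv; rewrite fcoord_basis {1}e ffunE (negPf nv).
    by rewrite eqxx.
  have [v nv nIJ] : exists2 v, v != t & I v != J v.
    apply/exists_inP; apply: contraNT ne => /exists_inPn h.
    apply/eqP/ffunP => v; rewrite ffunE; case: eqP => [->//|/eqP nv].
    by have := h v nv; rewrite negbK => /eqP.
  by rewrite (bigD1 v) //= fcoord_basis (negPf nIJ) mul0r mulr0.
rewrite (reindex_onto (upd t ^~ I) (fun J : idx => J t)) /=; last by move=> J /eqP.
by apply: eq_bigl => i; rewrite upd_at !eqxx.
Qed.

Definition slot_vec t (y : B) (I : idx) : A := \sum_i (y (upd t i I) : k) *: fbasis i.

Lemma slot_vec_upd t y i I : slot_vec t y (upd t i I) = slot_vec t y I.
Proof. by apply: eq_bigr => j _; rewrite upd_upd. Qed.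

Lemma slot_vec_coord t y (I : idx) : fcoord (I t) (slot_vec t y I) = y I.
Proof.
rewrite linear_sum (bigD1 (I t)) //= linearZ /= fcoord_basis eqxx upd_same.
rewrite big1 => [|i ni]; first by rewrite addr0 [LHS]mulr1.
by rewrite linearZ /= fcoord_basis eq_sym (negPf ni) [LHS]mulr0.
Qed.

Lemma slot_unit_mull t b y (I : idx) :
  (slot_unit t b * y) I = fcoord (I t) (b * slot_vec t y I) :> k.
Proof.
rewrite [y in LHS]tpow_sum mulr_sumr sum_ffunE /slot_vec mulr_sumr linear_sum /=.
transitivity (\sum_i (y (upd t i I) * fcoord (I t) (b * fbasis (upd t i I t)) : k)); last first.
  by apply: eq_bigr => i _; rewrite upd_at -scalerAr linearZ.
rewrite -(sum_off_slot t I (fun J : idx => y J * fcoord (I t) (b * fbasis (J t)))).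
apply: eq_bigr => J _; rewrite -scalerAr ffunE -mulrA; congr (_ * _).
rewrite -pure_slotE [_ * _]tmul_pure; congr (fun_of_fin _ I).
by apply: eq_pure => v; rewrite /slot; case: eqP => [->//|_]; rewrite mul1r.
Qed.

Lemma slot_unit_mulr t b y (I : idx) :
  (y * slot_unit t b) I = fcoord (I t) (slot_vec t y I * b) :> k.
Proof.
rewrite [y in LHS]tpow_sum mulr_suml sum_ffunE /slot_vec mulr_suml linear_sum /=.
transitivity (\sum_i (y (upd t i I) * fcoord (I t) (fbasis (upd t i I t) * b) : k)); last first.
  by apply: eq_bigr => i _; rewrite upd_at -scalerAl linearZ.
rewrite -(sum_off_slot t I (fun J : idx => y J * fcoord (I t) (fbasis (J t) * b))).
apply: eq_bigr => J _; rewrite -scalerAl ffunE -mulrA; congr (_ * _).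
rewrite -pure_slotE [_ * _]tmul_pure; congr (fun_of_fin _ I).
by apply: eq_pure => v; rewrite /slot; case: eqP => [->//|_]; rewrite mulr1.
Qed.

Lemma fcoord_inj (a b : A) : (forall i, fcoord i a = fcoord i b) -> a = b.
Proof. by move=> h; rewrite -(fcoordK a) -(fcoordK b); apply: eq_bigr => i _; rewrite h. Qed.

Lemma slot_vec_central t (y : B) : (forall b, slot_unit t b * y = y * slot_unit t b) ->
  forall I, is_central (slot_vec t y I).
Proof.
move=> yc I b; apply: fcoord_inj => i.
have := slot_unit_mulr t b y (upd t i I); rewrite -yc slot_unit_mull.
by rewrite upd_at slot_vec_upd.
Qed.

Lemma idx_exists : exists i : 'I_(dim A), true.
Proof.
case: (pickP (fun _ : 'I_(dim A) => true)) => [i _|h]; first by exists i.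
by have := oner_neq0 A; rewrite -(fcoordK 1) big_pred0 ?eqxx // => i; have := h i.
Qed.

Lemma slot_decomp t i0 (y : B) :
  y = \sum_(I : idx | I t == i0) pure (slot t (slot_vec t y I) (tbasis I)).
Proof.
apply/ffunP => K; rewrite sum_ffunE.
transitivity (\sum_(I : idx) (if I t == i0 then y (upd t (K t) I) else 0)
   * \prod_(v | v != t) fcoord (K v) (fbasis (I v) : A)).
  rewrite (sum_off_slot t K (fun I : idx => if I t == i0 then y (upd t (K t) I) else 0)).
  rewrite (bigD1 i0) //= upd_at eqxx upd_upd upd_same big1 ?addr0 // => i ni.
  by rewrite upd_at (negPf ni).
rewrite [RHS]big_mkcond; apply: eq_bigr => I _; case: eqP => _; last by rewrite mul0r.
rewrite pure_slotE; congr (_ * _).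
by rewrite -(slot_vec_coord t y (upd t (K t) I)) upd_at slot_vec_upd.
Qed.

Lemma mono_tens_span (x : M) (P : M -> Prop) :
  P 0 -> (forall y z, P y -> P z -> P (y + z)) ->
  (forall m, P (mono_tens 'X_[m] [ffun I => (x I)@_m])) -> P x.
Proof.
move=> P0 PD PX; pose D := \max_I msize (x I).
have -> : x = \sum_(m : 'X_{1..n < D}) mono_tens 'X_[m] [ffun I => (x I)@_m].
  apply/ffunP => I; rewrite sum_ffunE {1}[x I](@mpolywE _ _ D); last exact: leq_bigmax.
  by apply: eq_bigr => m _; rewrite !ffunE.
by apply: (big_ind P) => // m _; apply: PX.
Qed.

Lemma coeff_commutes (x : M) m (a : B) : tens_lmul a x = tens_rmul a x ->
  let y : B := [ffun I => (x I)@_m] in a * y = y * a.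
Proof.
move=> e y; have e' I : (tens_lmul a x I)@_m = (tens_rmul a x I)@_m by rewrite e.
apply/ffunP => I; rewrite [y]tpow_sum mulr_sumr mulr_suml !sum_ffunE.
have := e' I; rewrite !ffunE !linear_sum /= => e2.
transitivity (\sum_J ((a * e_ J : B) I *: x J)@_m).
  by apply: eq_bigr => J _; rewrite -scalerAr !ffunE mcoeffZ [LHS]mulrC.
rewrite e2; apply: eq_bigr => J _.
by rewrite -scalerAl !ffunE mcoeffZ [LHS]mulrC.
Qed.

Lemma slotwise_centerP (x : M) :
  slotwise_center x <-> forall a : B, tens_lmul a x = tens_rmul a x.
Proof.
split=> [xc|xc t]; first by apply: commutes_of_slots => t b; apply/central_slot_commutes/xc.
apply: mono_tens_span => [|y z|m]; [exact: central_slots0|exact: central_slotsD|].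
have yc b := coeff_commutes m (xc (slot_unit t b)).
set y : B := [ffun I => _] in yc *; have [i0 _] := idx_exists.
have -> : mono_tens 'X_[m] y = \sum_(I : idx | I t == i0)
    mono_tens 'X_[m] (pure (slot t (slot_vec t y I) (tbasis I))).
  rewrite {1}(slot_decomp t i0 y); apply/ffunP => K.
  by rewrite ffunE !sum_ffunE scaler_suml; apply: eq_bigr => I _; rewrite [RHS]ffunE.
apply: central_slots_sum => I _; rewrite -mtens_mono_tens.
apply: central_slots_mtens => s; rewrite inE => /eqP ->.
by rewrite /slot eqxx; apply: slot_vec_central.
Qed.

Section Projective.
Variables (r : nat) (p : {linear 'rV[k]_r -> A}) (s : A -> 'rV[k]_r).
Hypotheses (p_central : forall v, is_central (p v))
  (s_lin : forall (c : k) (x y : A), is_central x -> is_central y ->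
     s (c *: x + y) = c *: s x + s y)
  (sK : forall x : A, is_central x -> p (s x) = x).

Lemma is_central_lin (c : k) (x y : A) : is_central x -> is_central y -> is_central (c *: x + y).
Proof. by move=> cx cy b; rewrite mulrDl mulrDr -scalerAl -scalerAr cx cy. Qed.
Lemma is_central0 : is_central (0 : A).
Proof. by move=> b; rewrite mulr0 mul0r. Qed.

Lemma section_sum (I : finType) (c : I -> k) (v : I -> A) : (forall i, is_central (v i)) ->
  s (\sum_i c i *: v i) = \sum_i c i *: s (v i).
Proof.
move=> vc; suff [] : s (\sum_i c i *: v i) = \sum_i c i *: s (v i) /\
  is_central (\sum_i c i *: v i) by [].
elim/big_rec2: _ => [|i u v' _ [e cv]].
  split; last exact: is_central0.
  have := s_lin (-1) is_central0 is_central0.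
  by rewrite scaler0 addr0 scaleN1r addNr.
by split; [rewrite s_lin // e|apply: is_central_lin].
Qed.

Definition slot_section t j (y : B) : B := [ffun I : idx => s (slot_vec t y I) 0 j].

Lemma slot_section_decomp t (y : B) : (forall I, is_central (slot_vec t y I)) ->
  forall I : idx, y I = \sum_j slot_section t j y I * fcoord (I t) (p (delta_mx 0 j)) :> k.
Proof.
move=> yc I; rewrite -(slot_vec_coord t y I) -{1}(sK (yc I)).
rewrite {1}[s _]row_sum_delta !linear_sum; apply: eq_bigr => j _.
by rewrite !linearZ /= ffunE.
Qed.

Definition indep t (y : B) := forall I i, y (upd t i I) = y I.

Lemma indep_section t j y : indep t (slot_section t j y).
Proof. by move=> I i; rewrite !ffunE slot_vec_upd. Qed.

Lemma indep_section_other t u j y : t != u -> indep u y -> indep u (slot_section t j y).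
Proof.
move=> ntu yu I i; rewrite !ffunE; congr (s _ 0 j).
by apply: eq_bigr => l _; rewrite updC // yu.
Qed.

Lemma section_central t u j y : t != u ->
  (forall I, is_central (slot_vec t y I)) -> (forall I, is_central (slot_vec u y I)) ->
  forall I, is_central (slot_vec u (slot_section t j y) I).
Proof.
move=> ntu yt yu I b; apply: fcoord_inj => l.
pose V i := slot_vec t y (upd u i I).
have VE (F : A -> A) : linear F ->
    \sum_i fcoord l (F (fbasis i)) *: V i =
    \sum_m fcoord l (F (slot_vec u y (upd t m I))) *: fbasis m.
  move=> lF; pose f : {linear A -> A} := HB.pack F (GRing.isLinear.Build _ _ _ _ _ lF).
  under eq_bigr => i _ do rewrite scaler_sumr.
  rewrite exchange_big; apply: eq_bigr => m _ /=.
  rewrite -[F _]/(f _) !linear_sum scaler_suml; apply: eq_bigr => i _.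
  by rewrite !linearZ /= scalerA updC // mulrC.
have sE (F : A -> A) : linear F ->
    fcoord l (F (slot_vec u (slot_section t j y) I)) = s (\sum_i fcoord l (F (fbasis i)) *: V i) 0 j.
  move=> lF; pose f : {linear A -> A} := HB.pack F (GRing.isLinear.Build _ _ _ _ _ lF).
  rewrite section_sum; last by move=> i; apply: yt.
  rewrite summxE -[F _]/(f _) !linear_sum; apply: eq_bigr => i _.
  by rewrite !linearZ /= mxE ffunE mulrC.
have lr : linear (fun a : A => a * b) by move=> c x z; rewrite mulrDl scalerAl.
have ll : linear (fun a : A => b * a) by move=> c x z; rewrite mulrDr scalerAr.
rewrite (sE _ lr) (sE _ ll) (VE _ lr) (VE _ ll); congr (s _ 0 j).
by apply: eq_bigr => m _; rewrite yu.
Qed.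

Lemma indep_all y I J : (forall t, indep t y) -> y I = y J.
Proof.
move=> yi.
suff h c : (c <= n)%N -> y [ffun v : 'I_n => if (v < c)%N then J v else I v] = y I.
  rewrite -(h n (leqnn n)); congr (y _).
  by apply/ffunP => v; rewrite ffunE ltn_ord.
elim: c => [|c IHc] lec; first by congr (y _); apply/ffunP => v; rewrite ffunE.
rewrite -IHc; last exact: ltnW.
pose t := Ordinal lec; rewrite -[RHS](yi t _ (J t)); congr (y _).
apply/ffunP => v; rewrite !ffunE ltnS leq_eqVlt -val_eqE /=.
by case: ltngtP => //= e; congr (J _); apply: val_inj.
Qed.

Lemma section_span (l : seq 'I_n) (y : B) (P : B -> Prop) : uniq l ->
  P 0 -> (forall y z, P y -> P z -> P (y + z)) ->
  (forall (c : k) (a : 'I_n -> A), (forall t, is_central (a t)) ->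
     P [ffun I : idx => c * \prod_(t <- l) fcoord (I t) (a t)]) ->
  (forall t, t \in l -> forall I, is_central (slot_vec t y I)) ->
  (forall t, t \notin l -> indep t y) -> P y.
Proof.
elim: l y P => [|t l IHl] y P /=.
  move=> _ _ _ PG _ yi; have [i0 _] := idx_exists.
  have -> : y = [ffun I : idx => y [ffun=> i0] * \prod_(t <- [::]) fcoord (I t) (1 : A)].
    by apply/ffunP => I; rewrite ffunE big_nil mulr1; apply: indep_all => t; apply: yi.
  by apply: PG => t b; rewrite mul1r mulr1.
case/andP=> tl ul P0 PD PG yc yi.
have ytc := yc t (mem_head _ _).
pose z j : B := [ffun I : idx => slot_section t j y I * fcoord (I t) (p (delta_mx 0 j))].
have -> : y = \sum_j z j.
  apply/ffunP => I; rewrite sum_ffunE (slot_section_decomp ytc).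
  by apply: eq_bigr => j _; rewrite [RHS]ffunE.
apply: (big_ind P) => // j _; rewrite /z.
apply: (IHl _ (fun u : B => P [ffun I : idx => u I * fcoord (I t) (p (delta_mx 0 j))])) => //.
- suff -> : [ffun I : idx => (0 : B) I * fcoord (I t) (p (delta_mx 0 j))] = 0 :> B by [].
  by apply/ffunP => I; rewrite !ffunE mul0r.
- move=> u v Pu Pv; have := PD _ _ Pu Pv; congr P.
  by apply/ffunP => I; rewrite !ffunE mulrDl.
- move=> c a ca; have := PG c (slot t (p (delta_mx 0 j)) a).
  have -> : [ffun I : idx => c * \prod_(t0 <- t :: l) fcoord (I t0) (slot t (p (delta_mx 0 j)) a t0)]
     = [ffun I : idx => [ffun I : idx => c * \prod_(t0 <- l) fcoord (I t0) (a t0)] I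
         * fcoord (I t) (p (delta_mx 0 j))].
    apply/ffunP => I; rewrite !ffunE big_cons /slot eqxx mulrCA mulrC; congr (_ * _ * _).
    apply: eq_big_seq => v vl; rewrite ifN //.
    by apply: contraNneq tl => <-.
  by apply=> v; rewrite /slot; case: eqP => // _; apply: p_central.
- move=> u ul'; have ntu : t != u by apply: contraNneq tl => ->.
  by apply: section_central => //; apply: yc; rewrite in_cons ul' orbT.
- move=> u nul; have [->|nut] := eqVneq u t; first exact: indep_section.
  apply: indep_section_other; first by rewrite eq_sym.
  by apply: yi; rewrite in_cons negb_or nut.
Qed.

End Projective.

Lemma pure_centerP (x : M) : projective_center A ->
  pure_center x <-> forall a : B, tens_lmul a x = tens_rmul a x.
Proof.
move=> [r [p [s [p_central s_lin sK]]]]; split=> [xc|xc].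
  apply/slotwise_centerP => t; apply: central_slotsW xc; exact: subsetT.
apply: mono_tens_span => [|y z|m]; [exact: central_slots0|exact: central_slotsD|].
have yc t b := coeff_commutes m (xc (slot_unit t b)).
set y : B := [ffun I : idx => _] in yc *.
apply: (section_span (P := fun y => central_slots setT (mono_tens 'X_[m] y))
  p_central s_lin sK (enum_uniq 'I_n)).
- suff -> : mono_tens 'X_[m] 0 = 0 by apply: central_slots0.
  by apply/ffunP => I; rewrite !ffunE scale0r.
- move=> u v hu hv; have := central_slotsD hu hv; congr central_slots.
  by apply/ffunP => I; rewrite !ffunE scalerDl.
- move=> c a ca; have : central_slots setT (mtens (c *: 'X_[m]) a : M).
    by apply: central_slots_mtens => t _; apply: ca.
  congr central_slots; apply/ffunP => I.
  by rewrite !ffunE scalerA big_enum mulrC.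
- by move=> t _; apply: slot_vec_central => b; apply: yc.
- by move=> t; rewrite mem_enum.
Qed.

End SlotCenters.

(** * Jucys-Murphy elements *)

Section Wreath.
Variables (k : comNzRingType) (A : freeAlgType k) (gr : int -> A -> Prop) (d : int).
Variables (phi : {linear A -> 'Hom(A, k^o)}) (psi : 'Hom(A, k^o) -> A) (n : nat).
Hypotheses (sym : graded_symmetric gr d phi psi) (n_gt0 : (0 < n)%N).
Local Notation B := (tpow A n).
Local Notation V := (wreath n A).
Local Notation Delta := (@Delta k A phi psi n).
Local Notation H := (affinization n phi psi).

Definition wr (a : B) (w : 'S_n) : V := skew_in (place_action n A) a w.

Lemma wrM a u b v : wr a u * wr b v = wr (a * tplace u b) (v * u)%g.
Proof.
apply/ffunP => w; rewrite [LHS]skew_mulE (bigD1 u) //= big1 => [|x nx]; last first.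
  by rewrite ffunE (negPf nx) mul0r.
rewrite addr0 !ffunE eqxx (can2_eq (mulgKV u) (mulgK u)).
by case: eqP => // _; rewrite linear0 mulr0.
Qed.

Lemma wrZ c a w : wr (c *: a) w = c *: wr a w.
Proof. by apply/ffunP => u; rewrite !ffunE; case: eqP; rewrite ?scaler0. Qed.
Lemma wrD a b w : wr (a + b) w = wr a w + wr b w.
Proof. by apply/ffunP => u; rewrite !ffunE; case: eqP; rewrite ?addr0. Qed.
Lemma wr1 : wr 1 1%g = 1. Proof. by []. Qed.

Lemma wr_sum (y : V) : y = \sum_w wr (y w) w.
Proof.
apply/ffunP => w; rewrite sum_ffunE (bigD1 w) //= ffunE eqxx big1 ?addr0 // => u nu.
by rewrite ffunE eq_sym (negPf nu).
Qed.

Definition jucys_murphy (j : 'I_n) : V :=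
  - \sum_(t : 'I_n) ((t < j)%N%:R : k) *: wr (Delta j t) (tperm t j).
Local Notation L := jucys_murphy.

Lemma wr_jucys_murphy a j : wr a 1%g * L j = L j * wr a 1%g.
Proof.
rewrite mulrN mulNr mulr_sumr mulr_suml; congr (- _); apply: eq_bigr => t _.
rewrite -scalerAr -scalerAl !wrM tplace1 mul1g mulg1.
have [e|ne] := eqVneq t j; first by rewrite e ltnn !scale0r.
congr (_ *: wr _ _); rewrite [RHS](Delta_comm sym) 1?eq_sym // tplace_comp.
by rewrite [tperm j t]tpermC tperm2 tplace1.
Qed.

Lemma sym_jucys_murphy (i i' j : 'I_n) : i' = i.+1 :> nat ->
  wr 1 (tperm i i') * L j = L (tperm i i' j) * wr 1 (tperm i i')
    + ((i == j)%:R - (i' == j)%:R : k) *: wr (Delta i i') 1%g.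
Proof.
move=> ei; set s := tperm i i'.
have lt1 : (i < i')%N by rewrite ei.
have lt2 : (i' < i)%N = false by rewrite ei ltnNge leqnSn.
have nii : i != i' by rewrite -val_eqE /= ltn_eqF.
have nii1 := negPf nii; have nii2 : (i' == i) = false by rewrite eq_sym.
pose E t : V := wr (Delta (s j) (s t)) (tperm t j * s)%g.
have nE t : t != j -> wr 1 s * wr (Delta j t) (tperm t j) = E t.
  by move=> nt; rewrite wrM mul1r (tplace_Delta sym) 1?eq_sym.
have eL : wr 1 s * L j = - \sum_(t : 'I_n) ((t < j)%N%:R : k) *: E t.
  rewrite mulrN mulr_sumr; congr (- _); apply: eq_bigr => t _; rewrite -scalerAr.
  by have [->|nt] := eqVneq t j; [rewrite ltnn !scale0r|rewrite nE].
have eR : L (s j) * wr 1 s = - \sum_(t : 'I_n) ((s t < s j)%N%:R : k) *: E t.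
  rewrite mulNr mulr_suml (reindex_inj (@perm_inj _ s)); congr (- _); apply: eq_bigr => t _.
  rewrite -scalerAl wrM tplace_one mulr1; congr (_ *: wr _ _).
  by rewrite -tpermJ conjgE /s tpermV mulgA tperm2 mul1g.
suff eD : \sum_(t : 'I_n) ((s t < s j)%N%:R - (t < j)%N%:R : k) *: E t =
    ((i == j)%:R - (i' == j)%:R : k) *: wr (Delta i i') 1%g.
  rewrite eL eR -eD -!sumrN -big_split; apply: eq_bigr => t _.
  by rewrite scalerBl /= [RHS]addrA addNr [RHS]add0r.
have jst t : (j == s t) = (t == s j).
  by rewrite eq_sym (can2_eq (tpermK _ _) (tpermK _ _)).
have [sj|sj] := eqVneq (s j) j.
  have nij : (i == j) = false.
    by apply/negP => /eqP e; move/eqP: sj; rewrite -e /s tpermL nii2.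
  have nij' : (i' == j) = false.
    by apply/negP => /eqP e; move/eqP: sj; rewrite -e /s tpermR nii1.
  rewrite nij nij' subrr scale0r big1 // => t _.
  by rewrite ltn_tperm_adjacent ?subrr ?scale0r // -/s jst sj eq_sym andbN.
rewrite (bigD1 (s j)) //= big1 ?addr0 => [|t nt]; last first.
  by rewrite ltn_tperm_adjacent ?subrr ?scale0r // -/s jst (negPf nt).
rewrite /E [s (s j)]tpermK /s; case: tpermP sj => [->|->|_ _]; last by rewrite eqxx.
- by move=> _; rewrite lt1 lt2 nii2 eqxx [tperm i' i]tpermC tperm2 (DeltaC sym) // eq_sym.
- by move=> _; rewrite lt1 lt2 nii1 eqxx tperm2.
Qed.

Lemma jucys_murphy_comm j l v : L j * (L l * v) = L l * (L j * v).
Proof.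
pose Z m (u : V) := L m * u; pose W w (u : V) := wr 1 w * u.
pose D i i' (u : V) := wr (Delta i i') 1%g * u.
have Zl m : linear (Z m) by move=> c u u'; rewrite /Z mulrDr -scalerAr.
have Wl w : linear (W w) by move=> c u u'; rewrite /W mulrDr -scalerAr.
have DZ i i' m u : D i i' (Z m u) = Z m (D i i' u).
  by rewrite /D /Z !mulrA wr_jucys_murphy.
have WZ (i i' m : 'I_n) u : i' = i.+1 :> nat -> W (tperm i i') (Z m u) =
    Z (tperm i i' m) (W (tperm i i') u) + ((i == m)%:R - (i' == m)%:R : k) *: D i i' u.
  by move=> ei; rewrite /W /Z /D mulrA sym_jucys_murphy // mulrDl mulrA scalerAl.
have W1 u : W 1%g u = u by rewrite /W wr1 mul1r.
have WM u w x : W (w * u)%g x = W u (W w x) by rewrite /W mulrA wrM tplace_one mulr1.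
pose o := Ordinal n_gt0.
have L0 u : Z o u = 0.
  rewrite /Z /jucys_murphy big1 ?oppr0 ?mul0r // => t _.
  by rewrite ltn0 scale0r.
have /eqP := zcomm_zero Zl Wl DZ WZ W1 WM j l v L0.
by rewrite subr_eq0 => /eqP.
Qed.

Lemma wreath_affine :
  affine_action phi psi (fun j v => L j * v) (fun a v => wr a 1%g * v) (fun w v => wr 1 w * v).
Proof.
split.
- by move=> j c u v; rewrite mulrDr -scalerAr.
- exact: jucys_murphy_comm.
- split.
  + by move=> a c u v; rewrite mulrDr -scalerAr.
  + by move=> a b v; rewrite wrD mulrDl.
  + by move=> c a v; rewrite wrZ scalerAl.
  + by move=> a b v; rewrite mulrA wrM tplace1 mulg1.
  + by move=> v; rewrite wr1 mul1r.
- by move=> w c u v; rewrite mulrDr -scalerAr.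
- by move=> v; rewrite wr1 mul1r.
- by move=> u w v; rewrite mulrA wrM tplace_one mulr1.
- by move=> a j v; rewrite !mulrA wr_jucys_murphy.
- move=> i i' a v _; rewrite !mulrA !wrM mul1r mul1g tplace1 mulr1 mulg1.
  by [].
- by move=> i i' j v ei; rewrite mulrA sym_jucys_murphy // mulrDl mulrA scalerAl.
Qed.

Lemma wreath_quotient : exists f : {linear H -> V},
  monoid_morphism f /\ forall y, exists x, f x = y.
Proof.
have aa := wreath_affine.
pose act (h : H) v := aff_act (fun j v => L j * v) (fun a v => wr a 1%g * v) (fun w v => wr 1 w * v) h v.
have actE h v : act h v = act h 1 * v.
  rewrite /act; elim/fprod_ind: h v => [p|a|g|x y IHx IHy|x y IHx IHy|c x IHx] v.
  - rewrite -[fprod_inP _ p]/(aff_poly phi psi p) !(aff_act_poly aa).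
    have pa := mpoly_act_action (aa_Zlin aa) (aa_Zcomm aa).
    elim/mpoly_gen_ind: p v => [|i|c f g IHf IHg|f g IHf IHg] v.
    + by rewrite !(act1l pa) mul1r.
    + by rewrite !mpoly_actXU mulr1.
    + by rewrite !(actDl pa) !(actZl pa) IHf IHg mulrDl scalerAl.
    + rewrite [LHS](actMl pa) IHf IHg mulrA; congr (_ * v).
      by rewrite [RHS](actMl pa) [RHS]IHf.
  - by rewrite -[fprod_inT _ a]/(aff_tens phi psi a) !(aff_act_tens aa) mulr1.
  - rewrite -[fprod_inG _ g]/(aff_sym phi psi g) !(aff_act_sym aa) /sym_act mulr_suml.
    by apply: eq_bigr => w _; rewrite mulr1 scalerAl.
  - by rewrite !(aff_actDl aa) IHx IHy mulrDl.
  - by rewrite !(aff_actMl aa) IHx IHy [in RHS]IHx mulrA.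
  - by rewrite !(aff_actZl aa) IHx scalerAl.
have fl : linear (act^~ 1).
  by move=> c x y; rewrite /act (aff_actDl aa) (aff_actZl aa).
pose f := HB.pack_for {linear H -> V} (act^~ 1) (GRing.isLinear.Build _ _ _ _ _ fl).
exists f; split.
  split=> [|x y]; last by rewrite /= /act (aff_actMl aa) -/(act x _) actE.
  by rewrite /= /act -(@aff_poly1 k A phi psi n) (aff_act_poly aa) (act1l (mpoly_act_action (aa_Zlin aa) (aa_Zcomm aa))).
move=> y; exists (\sum_w aff_tens phi psi (y w) * aff_sym phi psi (symelt k w)).
rewrite linear_sum [RHS]wr_sum; apply: eq_bigr => w _ /=.
rewrite /act (aff_actMl aa) (aff_act_tens aa) (aff_act_sym aa) sym_act_elt mulr1.
by rewrite wrM tplace_one mulr1 mulg1.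
Qed.

End Wreath.

Theorem theoremB (k : comNzRingType) (A : freeAlgType k) (gr : int -> A -> Prop)
    (d : int) (phi : {linear A -> 'Hom(A, k^o)}) (psi : 'Hom(A, k^o) -> A)
    (n : nat) :
  noetherian k ->
  algebra_grading gr ->
  graded_symmetric gr d phi psi ->
  (0 < n)%N ->
  (* (i) *)
  (exists f : {linear affinization n phi psi -> polytens_sym A n}, bijective f) /\
  (* (ii) *)
  (free_left (@aff_poly k A n phi psi) /\ free_right (@aff_poly k A n phi psi) /\
   free_left (@aff_tens k A n phi psi) /\ free_right (@aff_tens k A n phi psi) /\
   free_left (@aff_sym k A n phi psi) /\ free_right (@aff_sym k A n phi psi)) /\
  (* (iii) *)
  (injective (@aff_embed k A n phi psi) /\
   (forall h : affinization n phi psi,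
      is_central h <->
      exists x : polytens A n,
        [/\ slotwise_center x, diag_invariant x & h = aff_embed phi psi x]) /\
   (projective_center A ->
    forall h : affinization n phi psi,
      is_central h <->
      exists x : polytens A n,
        [/\ pure_center x, diag_invariant x & h = aff_embed phi psi x])) /\
  (* (iv) *)
  (exists f : {linear affinization n phi psi -> wreath n A},
     monoid_morphism f /\ forall y, exists x, f x = y).
Proof.
move=> _ _ sym n_gt0.
split; last split; last split; last exact: wreath_quotient sym n_gt0.
- exists (HB.pack_for {linear affinization n phi psi -> polytens_sym A n}
    (@normal_form k A phi psi n) (GRing.isLinear.Build _ _ _ _ _ (normal_form_lin sym))).
  exists (@of_normal_form k A phi psi n); [exact: normal_formK sym|exact: of_normal_formK sym].
- split; first exact: free_left_poly sym.
  split; first exact: free_right_poly sym.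
  split; first exact: free_left_tens sym.
  split; first exact: free_right_tens sym.
  by split; [exact: free_left_sym sym|exact: free_right_sym sym].
- split; first exact: embed_inj sym.
  split=> [h|pc h]; apply: iff_trans (central_commutes sym h) _.
    by split=> -[x [xc xW ->]]; exists x; split=> //; apply/slotwise_centerP.
  by split=> -[x [xc xW ->]]; exists x; split=> //; apply/(pure_centerP _ pc).
Qed.
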